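(* Let $T,S$ be two 2-monads on a 2-category $\mathcal K$ satisfying Property L and let $\theta:S\to T$ be a strict monad morphism. Assume that the induced 2-functor $\theta^*:T\text{-Alg}_s\to S\text{-Alg}_s$ admits a left 2-adjoint $\theta_*$. Then there is an induced colax adjunction between $T\text{-Alg}_l$ and $S\text{-Alg}_l$, in which the induced 2-functor $\theta^*:T\text{-Alg}_l\to S\text{-Alg}_l$ is the right colax adjoint (i.e. $\theta^*:T\text{-Alg}_l\to S\text{-Alg}_l$ has a left colax adjoint).
   Context: For a 2-monad $T$ on $\mathcal K$, $T\text{-Alg}_s$ and $T\text{-Alg}_l$ are the 2-categories of strict $T$-algebras, strict (resp. lax) $T$-morphisms, and algebra 2-cells. For a strict morphism of 2-monads $\theta:S\to T$, $\theta^*$ sends a $T$-algebra $(A,a)$ to the $S$-algebra $(A,a\circ\theta_A)$, on both strict and lax morphisms. Property L for $T$: the inclusion $J:T\text{-Alg}_s\to T\text{-Alg}_l$ has a left 2-adjoint, and the 2-comonad $Q_l$ on $T\text{-Alg}_s$ generated by this 2-adjunction is lax-idempotent. A 2-comonad $(Q,\delta,q)$ (comultiplication $\delta$, counit $q$) is lax-idempotent if $\delta_A\dashv q_{QA}$ with identity unit for all $A$ (equivalently, it is a lax-idempotent 2-monad on the 2-category with 1-cells and 2-cells reversed). Colax adjunctions. For a pseudofunctor $K$ the structure isomorphisms are $\gamma:K(gf)\Rightarrow Kg\circ Kf$ and $\iota:K1_A\Rightarrow 1_{KA}$. A colax natural transformation $\alpha:K\Rightarrow K'$ consists of 1-cells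 $\alpha_A:KA\to K'A$ and 2-cells $\alpha_f:\alpha_B\circ Kf\Rightarrow K'f\circ\alpha_A$ for $f:A\to B$, subject to the usual unit, composition and local naturality axioms. A colax adjunction exhibiting $F:\mathcal X\to\mathcal Y$ as left colax adjoint to $U:\mathcal Y\to\mathcal X$ consists of pseudofunctors $F,U$, colax natural transformations $\eta:1_{\mathcal X}\Rightarrow UF$, $\epsilon:FU\Rightarrow 1_{\mathcal Y}$ and modifications $\Psi:\epsilon F\circ F\eta\to 1_F$, $\Phi:1_U\to U\epsilon\circ\eta U$ such that for all $A\in\mathcal X$, $B\in\mathcal Y$ the following composites are identities: $$\eta_A\xrightarrow{\Phi_{FA}\eta_A}U\epsilon_{FA}\,\eta_{UFA}\,\eta_A\xrightarrow{U\epsilon_{FA}\,\eta_{\eta_A}}U\epsilon_{FA}\,UF\eta_A\,\eta_A\xrightarrow{(U\Psi)_A\eta_A}\eta_A,$$ $$\epsilon_B\xrightarrow{\epsilon_B(F\Phi)_B}\epsilon_B\,FU\epsilon_B\,F\eta_{UB}\xrightarrow{\epsilon_{\epsilon_B}F\eta_{UB}}\epsilon_B\,\epsilon_{FUB}\,F\eta_{UB}\xrightarrow{\epsilon_B\Psi_{UB}}\epsilon_B,$$ where $(U\Psi)_A=\iota\circ U\Psi_A\circ\gamma^{-1}$ and $(F\Phi)_B=\gamma\circ F\Phi_B\circ\iota^{-1}$. *)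

(* Defs.v *)
From Stdlib Require Import ssreflect ClassicalEpsilon ProofIrrelevance.

Set Implicit Arguments.
Unset Strict Implicit.
Unset Printing Implicit Defensive.

(* 2-categories are strict: 1-cells compose strictly associatively for Leibniz
   equality.  An equation between 2-cells whose boundaries are equal, but not
   convertible, is stated as equality of the cells bundled with their
   boundaries. *)
Record cell (H : Type) (C : H -> H -> Type) :=
  Cell { src : H; tgt : H; cel : C src tgt }.

Definition same_cell (H : Type) (C : H -> H -> Type) (f g f' g' : H)
  (x : C f g) (y : C f' g') : Prop := Cell x = Cell y.

Notation "x ≡ y" := (same_cell x y) (at level 70, no associativity).

Lemma cellP (H : Type) (C : H -> H -> Type) (f g : H) (x y : C f g) : x ≡ y -> x = y.
Proof.
rewrite /same_cell => e.
pose P (c : cell C) := forall (p : src c = f) (q : tgt c = g),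
  eq_rect _ (fun s => C s g) (eq_rect _ (fun t => C (src c) t) (cel c) g q) f p = y.
have : P (Cell x).
  rewrite e => /= p q.
  by rewrite (proof_irrelevance _ p eq_refl) (proof_irrelevance _ q eq_refl).
by move=> /(_ eq_refl eq_refl).
Qed.

Record TwoCat := {
  ob :> Type;
  hom : ob -> ob -> Type;
  hom2 : forall A B : ob, hom A B -> hom A B -> Type;
  id1 : forall A, hom A A;
  comp1 : forall A B C, hom B C -> hom A B -> hom A C;
  id2 : forall A B (f : hom A B), hom2 f f;
  vcomp : forall A B (f g h : hom A B), hom2 g h -> hom2 f g -> hom2 f h;
  hcomp : forall A B C (g g' : hom B C) (f f' : hom A B),
    hom2 g g' -> hom2 f f' -> hom2 (comp1 g f) (comp1 g' f');
  comp1A : forall A B C D (h : hom C D) (g : hom B C) (f : hom A B),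
    comp1 h (comp1 g f) = comp1 (comp1 h g) f;
  comp1_idl : forall A B (f : hom A B), comp1 (id1 B) f = f;
  comp1_idr : forall A B (f : hom A B), comp1 f (id1 A) = f;
  vcompA : forall A B (f g h k : hom A B)
    (z : hom2 h k) (y : hom2 g h) (x : hom2 f g),
    vcomp z (vcomp y x) = vcomp (vcomp z y) x;
  vcomp_idl : forall A B (f g : hom A B) (x : hom2 f g), vcomp (id2 g) x = x;
  vcomp_idr : forall A B (f g : hom A B) (x : hom2 f g), vcomp x (id2 f) = x;
  hcomp_id2 : forall A B C (g : hom B C) (f : hom A B),
    hcomp (id2 g) (id2 f) = id2 (comp1 g f);
  interchange : forall A B C (g g' g'' : hom B C) (f f' f'' : hom A B)
    (y' : hom2 g' g'') (y : hom2 g g') (x' : hom2 f' f'') (x : hom2 f f'),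
    hcomp (vcomp y' y) (vcomp x' x) = vcomp (hcomp y' x') (hcomp y x);
  hcompA : forall A B C D (h h' : hom C D) (g g' : hom B C) (f f' : hom A B)
    (z : hom2 h h') (y : hom2 g g') (x : hom2 f f'),
    hcomp z (hcomp y x) ≡ hcomp (hcomp z y) x;
  hcomp_idl : forall A B (f g : hom A B) (x : hom2 f g),
    hcomp (id2 (id1 B)) x ≡ x;
  hcomp_idr : forall A B (f g : hom A B) (x : hom2 f g),
    hcomp x (id2 (id1 A)) ≡ x
}.

Arguments hom {K} A B : rename.
Arguments hom2 {K A B} f g : rename.
Arguments id1 {K} A : rename.
Arguments comp1 {K A B C} g f : rename.
Arguments id2 {K A B} f : rename.
Arguments vcomp {K A B f g h} y x : rename.
Arguments hcomp {K A B C g g' f f'} y x : rename.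
Arguments comp1A {K A B C D} h g f : rename.
Arguments comp1_idl {K A B} f : rename.
Arguments comp1_idr {K A B} f : rename.

Notation "g ∘ f" := (comp1 g f) (at level 40, left associativity).
Notation "f ⇒ g" := (hom2 f g) (at level 60, no associativity).
Notation "y • x" := (vcomp y x) (at level 50, left associativity).
Notation "y ∗ x" := (hcomp y x) (at level 40, left associativity).
Notation "g ◁ x" := (hcomp (id2 g) x) (at level 40, left associativity).
Notation "y ▷ f" := (hcomp y (id2 f)) (at level 40, left associativity).

Definition eqc (K : TwoCat) (A B : K) (f g : hom A B) (p : f = g) : f ⇒ g :=
  match p in _ = g' return f ⇒ g' with eq_refl => id2 f end.

(* Vertical composition of 2-cells whose middle boundaries are equal. *)
Definition vcompE (K : TwoCat) (A B : K) (f g g' h : hom A B)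
  (y : g' ⇒ h) (p : g = g') (x : f ⇒ g) : f ⇒ h := y • eqc p • x.
Notation "y •[ p ] x" := (vcompE y p x)
  (at level 50, left associativity, format "y  •[ p ]  x").

Definition recast (K : TwoCat) (A B : K) (f f' g g' : hom A B)
  (p : f' = f) (x : f ⇒ g) (q : g = g') : f' ⇒ g' := eqc q • x • eqc p.

(* Untyped calculus of 2-cells: horizontal composition is total on bundled
   cells, vertical composition is extended by a junk value. *)
Section Calculus.
Variable K : TwoCat.

Definition tcell (A B : K) : Type := cell (@hom2 K A B).
Definition idc (A B : K) (f : hom A B) : tcell A B := Cell (id2 f).
Definition hc (A B C : K) (y : tcell B C) (x : tcell A B) : tcell A C :=
  Cell (cel y ∗ cel x).
Definition vc (A B : K) (y x : tcell A B) : tcell A B :=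
  match excluded_middle_informative (tgt x = src y) with
  | left p => Cell (cel y •[p] cel x)
  | right _ => y
  end.

Lemma eqcE (A B : K) (f g : hom A B) (p : f = g) : Cell (eqc p) = idc f.
Proof. by case: g / p. Qed.

Lemma eqcE' (A B : K) (f g : hom A B) (p : f = g) : Cell (eqc p) = idc g.
Proof. by case: g / p. Qed.

Lemma vcE (A B : K) (f g g' h : hom A B) (y : g' ⇒ h) (p : g = g') (x : f ⇒ g) :
  Cell (y •[p] x) = vc (Cell y) (Cell x).
Proof.
rewrite /vc /=; case: excluded_middle_informative => [q|/(_ p)//].
by rewrite (proof_irrelevance _ p q).
Qed.

Lemma vcE1 (A B : K) (f g h : hom A B) (y : g ⇒ h) (x : f ⇒ g) :
  Cell (y • x) = vc (Cell y) (Cell x).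
Proof. by rewrite -(@vcE _ _ _ _ _ _ _ eq_refl) /vcompE /= vcomp_idr. Qed.

Lemma hcE (A B C : K) (g g' : hom B C) (f f' : hom A B) (y : g ⇒ g') (x : f ⇒ f') :
  Cell (y ∗ x) = hc (Cell y) (Cell x).
Proof. by []. Qed.

Lemma idE (A B : K) (f : hom A B) : Cell (id2 f) = idc f.
Proof. by []. Qed.

Lemma recastE (A B : K) (f f' g g' : hom A B) (p : f' = f) (x : f ⇒ g) (q : g = g') :
  Cell (recast p x q) = Cell x.
Proof.
by case: g' / q; case: f / p x => x; rewrite /recast /= vcomp_idl vcomp_idr.
Qed.

Lemma vcs (A B : K) (y x : tcell A B) : tgt x = src y -> src (vc y x) = src x.
Proof. by rewrite /vc; case: excluded_middle_informative. Qed.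
Lemma vct (A B : K) (y x : tcell A B) : tgt (vc y x) = tgt y.
Proof. by rewrite /vc; case: excluded_middle_informative. Qed.

Lemma vcA (A B : K) (z y x : tcell A B) : tgt x = src y -> tgt y = src z ->
  vc z (vc y x) = vc (vc z y) x.
Proof.
case: x y z => f g x [g' h y] [h' k z] /= p q; case: g' / p y => y.
case: h' / q z => z.
by rewrite -!vcE1 vcompA.
Qed.

Lemma vcIl (A B : K) (f : hom A B) (x : tcell A B) : tgt x = f -> vc (idc f) x = x.
Proof. by case: x => g h x /= <-; rewrite /idc -vcE1 vcomp_idl. Qed.
Lemma vcIr (A B : K) (f : hom A B) (x : tcell A B) : src x = f -> vc x (idc f) = x.
Proof. by case: x => g h x /= <-; rewrite /idc -vcE1 vcomp_idr. Qed.

Lemma hcA (A B C D : K) (z : tcell C D) (y : tcell B C) (x : tcell A B) :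
  hc z (hc y x) = hc (hc z y) x.
Proof. by case: x y z => f g x [? ? y] [? ? z]; apply: hcompA. Qed.
Lemma hcIl (A B : K) (x : tcell A B) : hc (idc (id1 B)) x = x.
Proof. by case: x => f g x; apply: hcomp_idl. Qed.
Lemma hcIr (A B : K) (x : tcell A B) : hc x (idc (id1 A)) = x.
Proof. by case: x => f g x; apply: hcomp_idr. Qed.
Lemma hcII (A B C : K) (g : hom B C) (f : hom A B) : hc (idc g) (idc f) = idc (g ∘ f).
Proof. by rewrite /hc /= hcomp_id2. Qed.

Lemma hc_vc (A B C : K) (y y' : tcell B C) (x x' : tcell A B) :
  tgt y = src y' -> tgt x = src x' ->
  hc (vc y' y) (vc x' x) = vc (hc y' x') (hc y x).
Proof.
case: x y x' y' => f g x [h k y] [g' g'' x'] [k' k'' y'] /= p q.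
case: k' / p y' => y'; case: g' / q x' => x'.
by rewrite -!vcE1 -!hcE interchange vcE1.
Qed.

Lemma hc_vcl (A B C : K) (y : hom B C) (x x' : tcell A B) :
  tgt x = src x' -> hc (idc y) (vc x' x) = vc (hc (idc y) x') (hc (idc y) x).
Proof. by move=> p; rewrite -hc_vc // vcIl. Qed.
Lemma hc_vcr (A B C : K) (y y' : tcell B C) (x : hom A B) :
  tgt y = src y' -> hc (vc y' y) (idc x) = vc (hc y' (idc x)) (hc y (idc x)).
Proof. by move=> p; rewrite -hc_vc // vcIl. Qed.

Lemma slide (A B C : K) (y : tcell B C) (x : tcell A B) :
  vc (hc (idc (tgt y)) x) (hc y (idc (src x))) = vc (hc y (idc (tgt x))) (hc (idc (src y)) x).
Proof. by rewrite -!hc_vc // !vcIl // !vcIr. Qed.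

Lemma vc_mid (A B : K) (p q q' r r' s : tcell A B) :
  tgt s = src r -> tgt r = src q -> tgt q = src p ->
  tgt s = src r' -> tgt r' = src q' -> tgt q' = src p ->
  vc q r = vc q' r' -> vc (vc p q) (vc r s) = vc (vc p q') (vc r' s).
Proof.
move=> *; rewrite -!(vcA (x := vc _ _)) ?vct // 1?(vcA (y := r)) // 1?(vcA (y := r')) //.
by congr vc; congr vc.
Qed.
End Calculus.

(* The action on cells only, without axioms.  With primitive projections,
   composition of these is associative and unital up to conversion. *)
Set Primitive Projections.
Record PreFunctor (X Y : TwoCat) := MkPre {
  fob :> X -> Y;
  fmap : forall A B : X, hom A B -> hom (fob A) (fob B);
  fmap2 : forall (A B : X) (f g : hom A B), f ⇒ g -> fmap f ⇒ fmap g
}.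
Unset Primitive Projections.
Arguments fmap {X Y} F {A B} f : rename.
Arguments fmap2 {X Y} F {A B f g} x : rename.

Definition pre_id (X : TwoCat) : PreFunctor X X :=
  {| fob := fun A => A; fmap := fun A B f => f; fmap2 := fun A B f g x => x |}.
Definition pre_comp (X Y Z : TwoCat) (G : PreFunctor Y Z) (F : PreFunctor X Y) :
  PreFunctor X Z :=
  {| fob := fun A => G (F A);
     fmap := fun A B f => fmap G (fmap F f);
     fmap2 := fun A B f g x => fmap2 G (fmap2 F x) |}.

Lemma same_fmap2 (X Y : TwoCat) (F : PreFunctor X Y) (A B : X) (f g f' g' : hom A B)
  (x : f ⇒ g) (y : f' ⇒ g') : x ≡ y -> fmap2 F x ≡ fmap2 F y.
Proof. by move=> e; exact: (f_equal (fun c => Cell (fmap2 F (cel c))) e). Qed.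

Record TwoFunctor (X Y : TwoCat) := {
  tf_pre :> PreFunctor X Y;
  tf_id : forall A : X, fmap tf_pre (id1 A) = id1 (tf_pre A);
  tf_comp : forall (A B C : X) (g : hom B C) (f : hom A B),
    fmap tf_pre (g ∘ f) = fmap tf_pre g ∘ fmap tf_pre f;
  tf_id2 : forall (A B : X) (f : hom A B), fmap2 tf_pre (id2 f) = id2 (fmap tf_pre f);
  tf_vcomp : forall (A B : X) (f g h : hom A B) (y : g ⇒ h) (x : f ⇒ g),
    fmap2 tf_pre (y • x) = fmap2 tf_pre y • fmap2 tf_pre x;
  tf_hcomp : forall (A B C : X) (g g' : hom B C) (f f' : hom A B)
    (y : g ⇒ g') (x : f ⇒ f'),
    fmap2 tf_pre (y ∗ x) ≡ fmap2 tf_pre y ∗ fmap2 tf_pre x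
}.
Arguments tf_id {X Y} F A : rename.
Arguments tf_comp {X Y} F {A B C} g f : rename.

Section CalculusF.
Variables (X Y : TwoCat) (F : TwoFunctor X Y).

Definition fc (A B : X) (x : tcell A B) : tcell (F A) (F B) := Cell (fmap2 F (cel x)).

Lemma fcE (A B : X) (f g : hom A B) (x : f ⇒ g) : Cell (fmap2 F x) = fc (Cell x).
Proof. by []. Qed.
Lemma fcI (A B : X) (f : hom A B) : fc (idc f) = idc (fmap F f).
Proof. by rewrite /fc /= tf_id2. Qed.
Lemma fc_vc (A B : X) (y x : tcell A B) : tgt x = src y -> fc (vc y x) = vc (fc y) (fc x).
Proof.
case: x y => f g x [g' h y] /= p; case: g' / p y => y.
by rewrite -vcE1 -!fcE -vcE1 tf_vcomp.
Qed.
Lemma fc_hc (A B C : X) (y : tcell B C) (x : tcell A B) : fc (hc y x) = hc (fc y) (fc x).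
Proof. by case: x y => f g x [? ? y]; apply: tf_hcomp. Qed.
End CalculusF.

Definition tf_idf (X : TwoCat) : TwoFunctor X X.
Proof. by exists (pre_id X). Defined.

Definition tf_compose (X Y Z : TwoCat) (G : TwoFunctor Y Z) (F : TwoFunctor X Y) :
  TwoFunctor X Z.
Proof.
exists (pre_comp G F) => /=.
- by move=> A; rewrite !tf_id.
- by move=> A B C g f; rewrite !tf_comp.
- by move=> A B f; rewrite !tf_id2.
- by move=> A B f g h y x; rewrite !tf_vcomp.
- move=> A B C g g' f f' y x.
  by rewrite /same_cell hcE !fcE hcE fc_hc fc_hc.
Defined.

Record TwoNat (X Y : TwoCat) (F G : TwoFunctor X Y) := {
  tn :> forall A : X, hom (F A) (G A);
  tn_nat : forall (A B : X) (f : hom A B), fmap G f ∘ tn A = tn B ∘ fmap F f;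
  tn_nat2 : forall (A B : X) (f g : hom A B) (x : f ⇒ g),
    fmap2 G x ▷ tn A ≡ tn B ◁ fmap2 F x
}.
Arguments tn {X Y F G} t A : rename.
Arguments tn_nat {X Y F G} t {A B} f : rename.
Arguments tn_nat2 {X Y F G} t {A B f g} x : rename.

(* L is left 2-adjoint to R. *)
Record TwoAdjunction (X Y : TwoCat) (L : TwoFunctor X Y) (R : TwoFunctor Y X) := {
  ta_unit : TwoNat (tf_idf X) (tf_compose R L);
  ta_counit : TwoNat (tf_compose L R) (tf_idf Y);
  ta_triL : forall A : X, ta_counit (L A) ∘ fmap L (ta_unit A) = id1 (L A);
  ta_triR : forall B : Y, fmap R (ta_counit B) ∘ ta_unit (R B) = id1 (R B)
}.

Definition has_left_2adjoint (X Y : TwoCat) (R : TwoFunctor Y X) : Prop :=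
  exists L : TwoFunctor X Y, inhabited (TwoAdjunction L R).

Record TwoMonad (K : TwoCat) := {
  tm :> TwoFunctor K K;
  tm_eta : TwoNat (tf_idf K) tm;
  tm_mu : TwoNat (tf_compose tm tm) tm;
  tm_unitl : forall A : K, tm_mu A ∘ tm_eta (tm A) = id1 (tm A);
  tm_unitr : forall A : K, tm_mu A ∘ fmap tm (tm_eta A) = id1 (tm A);
  tm_assoc : forall A : K, tm_mu A ∘ tm_mu (tm A) = tm_mu A ∘ fmap tm (tm_mu A)
}.

Record MonadMorphism (K : TwoCat) (S T : TwoMonad K) := {
  mm :> TwoNat S T;
  mm_eta : forall A : K, mm A ∘ tm_eta S A = tm_eta T A;
  mm_mu : forall A : K,
    mm A ∘ tm_mu S A = tm_mu T A ∘ (fmap T (mm A) ∘ mm (S A))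
}.

Record TwoComonad (K : TwoCat) := {
  tcm :> TwoFunctor K K;
  tcm_delta : TwoNat tcm (tf_compose tcm tcm);
  tcm_q : TwoNat tcm (tf_idf K);
  tcm_counitl : forall A : K, tcm_q (tcm A) ∘ tcm_delta A = id1 (tcm A);
  tcm_counitr : forall A : K, fmap tcm (tcm_q A) ∘ tcm_delta A = id1 (tcm A);
  tcm_coassoc : forall A : K,
    tcm_delta (tcm A) ∘ tcm_delta A = fmap tcm (tcm_delta A) ∘ tcm_delta A
}.

Definition comult_of_adjunction (X Y : TwoCat) (L : TwoFunctor X Y)
  (R : TwoFunctor Y X) (a : TwoAdjunction L R) :
  TwoNat (tf_compose L R) (tf_compose (tf_compose L R) (tf_compose L R)).
Proof.
unshelve refine (@Build_TwoNat _ _ (tf_compose L R)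
  (tf_compose (tf_compose L R) (tf_compose L R))
  (fun B => fmap L (ta_unit a (R B))) _ _) => /=.
- move=> A B f; rewrite -!tf_comp; congr (fmap L _).
  exact: (tn_nat (ta_unit a) (fmap R f)).
- move=> A B f g x.
  have e := same_fmap2 L (tn_nat2 (ta_unit a) (fmap2 R x)).
  rewrite /same_cell !fcE !hcE !fc_hc /= !idE !fcI in e.
  by rewrite /same_cell !hcE.
Defined.

Definition comonad_of_adjunction (X Y : TwoCat) (L : TwoFunctor X Y)
  (R : TwoFunctor Y X) (a : TwoAdjunction L R) : TwoComonad Y.
Proof.
refine {| tcm := tf_compose L R;
          tcm_delta := comult_of_adjunction a;
          tcm_q := ta_counit a |}.
- move=> A; exact: (ta_triL a (R A)).
- move=> A /=; by rewrite -tf_comp ta_triR tf_id.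
- move=> A /=; rewrite -!tf_comp; congr (fmap L _).
  exact: eq_sym (tn_nat (ta_unit a) (ta_unit a (R A))).
Defined.

(* The adjunction f ⊣ g in a 2-category, with unit u and counit c. *)
Definition is_adjunction (K : TwoCat) (A B : K) (f : hom A B) (g : hom B A)
  (u : id1 A ⇒ g ∘ f) (c : f ∘ g ⇒ id1 B) : Prop :=
  ((c ▷ f) •[comp1A f g f] (f ◁ u) ≡ id2 f) /\
  ((g ◁ c) •[eq_sym (comp1A g f g)] (u ▷ g) ≡ id2 g).

Definition lax_idempotent_comonad (K : TwoCat) (Q : TwoComonad K) : Prop :=
  forall A : K, exists (p : id1 (Q A) = tcm_q Q (Q A) ∘ tcm_delta Q A)
    (c : tcm_delta Q A ∘ tcm_q Q (Q A) ⇒ id1 (Q (Q A))),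
    is_adjunction (eqc p) c.

Section Algebras.
Variables (K : TwoCat) (T : TwoMonad K).

Lemma eta_nat (A B : K) (f : hom A B) : fmap T f ∘ tm_eta T A = tm_eta T B ∘ f.
Proof. exact: (tn_nat (tm_eta T) f). Qed.
Lemma mu_nat (A B : K) (f : hom A B) :
  fmap T f ∘ tm_mu T A = tm_mu T B ∘ fmap T (fmap T f).
Proof. exact: (tn_nat (tm_mu T) f). Qed.
Lemma eta_nat2 (A B : K) (x : tcell A B) :
  hc (fc T x) (idc (tm_eta T A)) = hc (idc (tm_eta T B)) x.
Proof. case: x => f g x; exact: (tn_nat2 (tm_eta T) x). Qed.
Lemma mu_nat2 (A B : K) (x : tcell A B) :
  hc (fc T x) (idc (tm_mu T A)) = hc (idc (tm_mu T B)) (fc T (fc T x)).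
Proof. case: x => f g x; exact: (tn_nat2 (tm_mu T) x). Qed.

Record Alg := {
  al :> K;
  al_str : hom (T al) al;
  al_unit : al_str ∘ tm_eta T al = id1 al;
  al_mult : al_str ∘ tm_mu T al = al_str ∘ fmap T al_str
}.

Record SHom (A B : Alg) := {
  sh :> hom A B;
  sh_eq : sh ∘ al_str A = al_str B ∘ fmap T sh
}.

Record SCell (A B : Alg) (f g : SHom A B) := {
  sc :> f ⇒ g;
  sc_eq : sc ▷ al_str A ≡ al_str B ◁ fmap2 T sc
}.

Lemma fmapc (X Y Z : K) (W : K) (b : hom (T Z) W) (g : hom Y Z) (f : hom X Y) :
  b ∘ fmap T (g ∘ f) = b ∘ fmap T g ∘ fmap T f.
Proof. by rewrite tf_comp comp1A. Qed.

Record LHom (A B : Alg) := {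
  lh :> hom A B;
  lh_cell : al_str B ∘ fmap T lh ⇒ lh ∘ al_str A;
  lh_unit : lh_cell ▷ tm_eta T A ≡ id2 lh;
  lh_mult : lh_cell ▷ tm_mu T A ≡
    (lh_cell ▷ fmap T (al_str A)) •[fmapc (al_str B) lh (al_str A)]
    (al_str B ◁ fmap2 T lh_cell)
}.

Record LCell (A B : Alg) (f g : LHom A B) := {
  lc :> f ⇒ g;
  lc_eq : (lc ▷ al_str A) • lh_cell f = lh_cell g • (al_str B ◁ fmap2 T lc)
}.

Lemma shom_ext (A B : Alg) (f g : SHom A B) : sh f = sh g -> f = g.
Proof.
case: f g => f p [g q] /= e; case: g / e q => q.
by rewrite (proof_irrelevance _ p q).
Qed.

Lemma scell_ext (A B : Alg) (f g f' g' : SHom A B) (x : SCell f g) (y : SCell f' g') :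
  sc x ≡ sc y -> x ≡ y.
Proof.
move=> e.
have ef : f = f' by apply: shom_ext; exact: (f_equal (@src _ _) e).
have eg : g = g' by apply: shom_ext; exact: (f_equal (@tgt _ _) e).
case: f' / ef y e => y; case: g' / eg y => y e.
move: (cellP e); case: x y {e} => x p [y q] /= e; case: y / e q => q.
by rewrite (proof_irrelevance _ p q).
Qed.

Lemma scM (A B : Alg) (f g : SHom A B) (x : SCell f g) :
  hc (Cell (sc x)) (idc (al_str A)) = hc (idc (al_str B)) (fc T (Cell (sc x))).
Proof. exact: (sc_eq x). Qed.

Definition sh_id (A : Alg) : SHom A A.
Proof. by exists (id1 (al A)); rewrite tf_id comp1_idl comp1_idr. Defined.

Definition sh_comp (A B C : Alg) (g : SHom B C) (f : SHom A B) : SHom A C.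
Proof.
by exists (g ∘ f); rewrite fmapc -sh_eq -!comp1A sh_eq.
Defined.

Definition sc_id (A B : Alg) (f : SHom A B) : SCell f f.
Proof.
by exists (id2 (sh f)); rewrite /same_cell !hcE fcE !idE fcI !hcII sh_eq.
Defined.

Definition sc_vcomp (A B : Alg) (f g h : SHom A B) (y : SCell g h) (x : SCell f g) :
  SCell f h.
Proof.
exists (sc y • sc x).
rewrite /same_cell !hcE fcE !vcE1 !idE.
by rewrite fc_vc // hc_vcl // -!scM hc_vcr.
Defined.

Definition sc_hcomp (A B C : Alg) (g g' : SHom B C) (f f' : SHom A B)
  (y : SCell g g') (x : SCell f f') : SCell (sh_comp g f) (sh_comp g' f').
Proof.
exists (sc y ∗ sc x).
rewrite /same_cell !hcE fcE !hcE !idE.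
by rewrite fc_hc hcA -scM -!hcA scM.
Defined.

Definition AlgS : TwoCat.
Proof.
unshelve refine {| ob := Alg; hom := SHom; hom2 := SCell; id1 := sh_id;
  comp1 := sh_comp; id2 := sc_id; vcomp := sc_vcomp; hcomp := sc_hcomp |}.
- by move=> *; apply: shom_ext => /=; rewrite comp1A.
- by move=> *; apply: shom_ext => /=; rewrite comp1_idl.
- by move=> *; apply: shom_ext => /=; rewrite comp1_idr.
- by move=> *; apply: cellP; apply: scell_ext; rewrite /same_cell /= vcompA.
- by move=> *; apply: cellP; apply: scell_ext; rewrite /same_cell /= vcomp_idl.
- by move=> *; apply: cellP; apply: scell_ext; rewrite /same_cell /= vcomp_idr.
- by move=> *; apply: cellP; apply: scell_ext; rewrite /same_cell /= hcomp_id2.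
- by move=> *; apply: cellP; apply: scell_ext; rewrite /same_cell /= interchange.
- by move=> *; apply: scell_ext; apply: hcompA.
- by move=> *; apply: scell_ext; apply: hcomp_idl.
- by move=> *; apply: scell_ext; apply: hcomp_idr.
Defined.

Lemma lhom_ext (A B : Alg) (f g : LHom A B) :
  lh f = lh g -> lh_cell f ≡ lh_cell g -> f = g.
Proof.
case: f g => f x u m [g y v n] /= e; case: g / e y v n => y v n e.
move: (cellP e) => e'; case: y / e' v n {e} => v n.
by rewrite (proof_irrelevance _ u v) (proof_irrelevance _ m n).
Qed.

Lemma lcell_ext (A B : Alg) (f g f' g' : LHom A B) (x : LCell f g) (y : LCell f' g') :
  f = f' -> g = g' -> lc x ≡ lc y -> x ≡ y.
Proof.
move=> ef eg; case: f' / ef y => y; case: g' / eg y => y e.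
move: (cellP e); case: x y {e} => x p [y q] /= e; case: y / e q => q.
by rewrite (proof_irrelevance _ p q).
Qed.

Definition lcl (A B : Alg) (f : LHom A B) : tcell (T A) B := Cell (lh_cell f).

Lemma lhU (A B : Alg) (f : LHom A B) : hc (lcl f) (idc (tm_eta T A)) = idc (lh f).
Proof. exact: (lh_unit f). Qed.
Lemma lhM (A B : Alg) (f : LHom A B) : hc (lcl f) (idc (tm_mu T A)) =
  vc (hc (lcl f) (idc (fmap T (al_str A)))) (hc (idc (al_str B)) (fc T (lcl f))).
Proof. by have := lh_mult f; rewrite /same_cell vcE. Qed.
Lemma lcM (A B : Alg) (f g : LHom A B) (x : LCell f g) :
  vc (hc (Cell (lc x)) (idc (al_str A))) (lcl f) =
  vc (lcl g) (hc (idc (al_str B)) (fc T (Cell (lc x)))).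
Proof. by have := lc_eq x; rewrite /lcl -fcE -!hcE -!vcE1 => ->. Qed.

Lemma lh_id_bd (A : Alg) : al_str A ∘ fmap T (id1 (al A)) = id1 (al A) ∘ al_str A.
Proof. by rewrite tf_id comp1_idl comp1_idr. Qed.

Definition lax_of_strict (A B : Alg) (f : SHom A B) : LHom A B.
Proof.
exists (sh f) (eqc (eq_sym (sh_eq f))).
- by rewrite /same_cell hcE eqcE' !idE hcII -comp1A al_unit comp1_idr.
- rewrite /same_cell vcE !hcE. rewrite (fcE T) eqcE' !idE fcI !hcII vcIl /=.
    by rewrite fmapc sh_eq.
  by rewrite fmapc -sh_eq -!comp1A al_mult.
Defined.

Definition lh_id (A : Alg) : LHom A A := lax_of_strict (sh_id A).

Definition lh_comp_cell (A B C : Alg) (g : LHom B C) (f : LHom A B) :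
  al_str C ∘ fmap T (g ∘ f) ⇒ g ∘ f ∘ al_str A :=
  recast (fmapc (al_str C) g f)
    ((lh g ◁ lh_cell f) •[eq_sym (comp1A (lh g) _ _)] (lh_cell g ▷ fmap T f))
    (comp1A (lh g) f (al_str A)).

Lemma lh_comp_cellE (A B C : Alg) (g : LHom B C) (f : LHom A B) :
  Cell (lh_comp_cell g f) = vc (hc (idc (lh g)) (lcl f)) (hc (lcl g) (idc (fmap T f))).
Proof. by rewrite recastE vcE !hcE. Qed.

Definition lh_comp (A B C : Alg) (g : LHom B C) (f : LHom A B) : LHom A C.
Proof.
exists (g ∘ f) (lh_comp_cell g f).
- rewrite /same_cell hcE lh_comp_cellE idE hc_vcr /= ?comp1A // -!hcA lhU !hcII.
  by rewrite eta_nat -(hcII (tm_eta T B) f) hcA lhU !hcII vcIl.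
- rewrite /same_cell vcE !hcE (fcE T) lh_comp_cellE !idE.
  rewrite hc_vcr /= ?comp1A // -!hcA lhM hcII mu_nat -(hcII (tm_mu T B)) hcA lhM.
  rewrite fc_vc /= ?comp1A // !fc_hc !fcI.
  rewrite hc_vcl /= ?tf_comp ?comp1A // hc_vcr /= ?tf_comp ?comp1A //.
  rewrite hc_vcl /= ?tf_comp ?comp1A // hc_vcr /= ?tf_comp ?comp1A //.
  rewrite !hcA; apply: vc_mid; rewrite /= ?tf_comp ?comp1A //.
  rewrite !hcII -!hcA !hcII.
  by have := slide (lcl g) (fc T (lcl f)); rewrite /= !tf_comp.
Defined.

Lemma lh_idE (A : Alg) : lcl (lh_id A) = idc (al_str A).
Proof. by rewrite /lcl /= eqcE'  comp1_idl. Qed.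

Lemma lh_compE (A B C : Alg) (g : LHom B C) (f : LHom A B) :
  lcl (lh_comp g f) = vc (hc (idc (lh g)) (lcl f)) (hc (lcl g) (idc (fmap T f))).
Proof. exact: lh_comp_cellE. Qed.

Lemma lcM_inv (A B : Alg) (f g : LHom A B) (x : lh f ⇒ lh g) :
  vc (hc (Cell x) (idc (al_str A))) (lcl f) =
  vc (lcl g) (hc (idc (al_str B)) (fc T (Cell x))) ->
  (x ▷ al_str A) • lh_cell f = lh_cell g • (al_str B ◁ fmap2 T x).
Proof. by move=> e; apply: cellP; rewrite /same_cell !vcE1. Qed.

Definition lc_id (A B : Alg) (f : LHom A B) : LCell f f.
Proof.
exists (id2 (lh f)).
by rewrite tf_id2 !hcomp_id2 vcomp_idl vcomp_idr.
Defined.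

Definition lc_vcomp (A B : Alg) (f g h : LHom A B) (y : LCell g h) (x : LCell f g) :
  LCell f h.
Proof.
exists (lc y • lc x); apply: lcM_inv.
rewrite !vcE1 fc_vc // hc_vcl // hc_vcr //.
by rewrite -vcA //= lcM !vcA //= lcM.
Defined.

Definition lc_hcomp (A B C : Alg) (g g' : LHom B C) (f f' : LHom A B)
  (y : LCell g g') (x : LCell f f') : LCell (lh_comp g f) (lh_comp g' f').
Proof.
exists (lc y ∗ lc x); apply: lcM_inv.
rewrite !lh_compE !hcE fc_hc vcA /= ?comp1A // -hcA -hc_vc //= vcIr // lcM.
rewrite -{1}(@vcIl _ _ _ (lh g') (Cell (lc y))) // hc_vc //=.
rewrite -!vcA /= ?comp1A // hcA -hc_vc //= vcIr // lcM.
by rewrite -{1}(@vcIl _ _ _ (fmap T f') (fc T (Cell (lc x)))) // hc_vc // hcA.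
Defined.

Lemma lhom_ext' (A B : Alg) (f g : LHom A B) : lh f = lh g -> lcl f = lcl g -> f = g.
Proof. exact: lhom_ext. Qed.

Lemma lh_compA (A B C D : Alg) (h : LHom C D) (g : LHom B C) (f : LHom A B) :
  lh_comp h (lh_comp g f) = lh_comp (lh_comp h g) f.
Proof.
apply: lhom_ext'; first exact: comp1A.
rewrite !lh_compE hc_vcl /= ?comp1A // hc_vcr /= ?comp1A //.
by rewrite tf_comp -!hcII !hcA vcA //= ?comp1A.
Qed.

Lemma lh_compIl (A B : Alg) (f : LHom A B) : lh_comp (lh_id B) f = f.
Proof.
apply: lhom_ext'; first exact: comp1_idl.
by rewrite lh_compE lh_idE hcII hcIl vcIr.
Qed.

Lemma lh_compIr (A B : Alg) (f : LHom A B) : lh_comp f (lh_id A) = f.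
Proof.
apply: lhom_ext'; first exact: comp1_idr.
by rewrite lh_compE lh_idE hcII /= tf_id hcIr vcIl.
Qed.

Definition AlgL : TwoCat.
Proof.
unshelve refine {| ob := Alg; hom := LHom; hom2 := LCell; id1 := lh_id;
  comp1 := lh_comp; id2 := lc_id; vcomp := lc_vcomp; hcomp := lc_hcomp |}.
- exact: lh_compA.
- exact: lh_compIl.
- exact: lh_compIr.
- by move=> *; apply: cellP; apply: lcell_ext => //; rewrite /same_cell /= vcompA.
- by move=> *; apply: cellP; apply: lcell_ext => //; rewrite /same_cell /= vcomp_idl.
- by move=> *; apply: cellP; apply: lcell_ext => //; rewrite /same_cell /= vcomp_idr.
- by move=> *; apply: cellP; apply: lcell_ext => //; rewrite /same_cell /= hcomp_id2.
- by move=> *; apply: cellP; apply: lcell_ext => //; rewrite /same_cell /= interchange.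
- by move=> *; apply: lcell_ext; rewrite ?lh_compA //; apply: hcompA.
- by move=> *; apply: lcell_ext; rewrite ?lh_compIl //; apply: hcomp_idl.
- by move=> *; apply: lcell_ext; rewrite ?lh_compIr //; apply: hcomp_idr.
Defined.

Lemma lcl_strict (A B : Alg) (f : SHom A B) :
  lcl (lax_of_strict f) = idc (sh f ∘ al_str A).
Proof. by rewrite /lcl /= eqcE'. Qed.

Definition lax_of_strict_cell (A B : Alg) (f g : SHom A B) (x : SCell f g) :
  LCell (lax_of_strict f) (lax_of_strict g).
Proof.
exists (sc x); apply: lcM_inv.
by rewrite !lcl_strict vcIr // vcIl /= ?sh_eq // scM.
Defined.

Lemma lax_of_strict_comp (A B C : Alg) (g : SHom B C) (f : SHom A B) :
  lax_of_strict (sh_comp g f) = lh_comp (lax_of_strict g) (lax_of_strict f).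
Proof.
apply: lhom_ext' => //.
by rewrite lh_compE !lcl_strict !hcII vcIr /= -!comp1A // sh_eq.
Qed.

Definition inclusionJ : TwoFunctor AlgS AlgL.
Proof.
unshelve refine (@Build_TwoFunctor AlgS AlgL
  (@MkPre AlgS AlgL (fun A => A) lax_of_strict lax_of_strict_cell) _ _ _ _ _) => //=.
- exact: lax_of_strict_comp.
- by move=> A B f; apply: cellP; apply: lcell_ext.
- by move=> A B f g h y x; apply: cellP; apply: lcell_ext.
- by move=> A B C g g' f f' y x; apply: lcell_ext; rewrite -?lax_of_strict_comp.
Defined.

(* Left 2-adjoints of J are unique up to isomorphism, so it does not matter which
   one generates the comonad. *)
Definition PropertyL : Prop :=
  exists (L : TwoFunctor AlgL AlgS) (a : TwoAdjunction L inclusionJ),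
    lax_idempotent_comonad (comonad_of_adjunction a).

End Algebras.

Section Restriction.
Variables (K : TwoCat) (S T : TwoMonad K) (θ : MonadMorphism S T).

Lemma mm_nat (A B : K) (f : hom A B) : fmap T f ∘ θ A = θ B ∘ fmap S f.
Proof. exact: (tn_nat θ). Qed.
Lemma mm_nat2 (A B : K) (x : tcell A B) : hc (fc T x) (idc (θ A)) = hc (idc (θ B)) (fc S x).
Proof. case: x => f g x; exact: (tn_nat2 θ x). Qed.

Definition restrict_alg (A : Alg T) : Alg S.
Proof.
exists (al A) (al_str A ∘ θ A).
- by rewrite -comp1A mm_eta al_unit.
- by rewrite -!comp1A mm_mu -(mm_nat (al_str A ∘ θ A)) tf_comp !comp1A al_mult.
Defined.

Definition restrict_shom (A B : Alg T) (f : SHom A B) :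
  SHom (restrict_alg A) (restrict_alg B).
Proof.
refine (@Build_SHom _ S (restrict_alg A) (restrict_alg B) (@sh _ _ A B f) _) => /=.
by rewrite comp1A sh_eq -!comp1A mm_nat.
Defined.

Definition restrict_scell (A B : Alg T) (f g : SHom A B) (x : SCell f g) :
  SCell (restrict_shom f) (restrict_shom g).
Proof.
refine (@Build_SCell _ S _ _ (restrict_shom f) (restrict_shom g) (@sc _ _ _ _ _ _ x) _).
rewrite /same_cell /= !hcE (fcE S) !idE -!hcII hcA scM.
by rewrite -!hcA mm_nat2.
Defined.

Definition restrict_s : TwoFunctor (AlgS T) (AlgS S).
Proof.
unshelve refine (@Build_TwoFunctor (AlgS T) (AlgS S)
  (@MkPre (AlgS T) (AlgS S) restrict_alg restrict_shom restrict_scell) _ _ _ _ _) => /=.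
- by move=> A; apply: shom_ext.
- by move=> A B C g f; apply: shom_ext.
- by move=> A B f; apply: cellP; apply: scell_ext.
- by move=> A B f g h y x; apply: cellP; apply: scell_ext.
- by move=> A B C g g' f f' y x; apply: scell_ext.
Defined.

Lemma restrict_src (A B : Alg T) (f : LHom A B) :
  al_str (restrict_alg B) ∘ fmap S f = al_str B ∘ fmap T f ∘ θ A.
Proof. by rewrite /= -!comp1A mm_nat. Qed.

Definition restrict_lh_cell (A B : Alg T) (f : LHom A B) :
  al_str (restrict_alg B) ∘ fmap S f ⇒ lh f ∘ al_str (restrict_alg A) :=
  recast (restrict_src f) (lh_cell f ▷ θ A) (eq_sym (comp1A (lh f) _ _)).

Lemma restrict_lh_cellE (A B : Alg T) (f : LHom A B) :
  Cell (restrict_lh_cell f) = hc (lcl f) (idc (θ A)).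
Proof. exact: recastE. Qed.

Definition restrict_lhom (A B : Alg T) (f : LHom A B) :
  LHom (restrict_alg A) (restrict_alg B).
Proof.
refine (@Build_LHom _ S (restrict_alg A) (restrict_alg B) (@lh _ _ A B f)
  (restrict_lh_cell f) _ _).
- by rewrite /same_cell hcE restrict_lh_cellE /= -hcA hcII mm_eta lhU.
- rewrite /same_cell vcE !hcE (fcE S) restrict_lh_cellE /= !idE fc_hc fcI.
  rewrite -!hcA !hcII mm_mu -hcII hcA lhM hc_vcr /= -?fmapc ?comp1A // ?fmapc //.
  rewrite (mm_nat (θ A)) -(mm_nat (al_str A)) -!hcII -!hcA.
  by rewrite (hcA (idc (θ B)) (fc S (lcl f))) -mm_nat2 -!hcA.
Defined.

Lemma restrict_lhomE (A B : Alg T) (f : LHom A B) :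
  lcl (restrict_lhom f) = hc (lcl f) (idc (θ A)).
Proof. exact: restrict_lh_cellE. Qed.

Definition restrict_lcell (A B : Alg T) (f g : LHom A B) (x : LCell f g) :
  LCell (restrict_lhom f) (restrict_lhom g).
Proof.
refine (@Build_LCell _ S _ _ (restrict_lhom f) (restrict_lhom g) (@lc _ _ _ _ _ _ x) _).
apply: lcM_inv; rewrite !restrict_lhomE /= -!hcII hcA -hc_vcr // lcM.
by rewrite hc_vcr // -!hcA mm_nat2.
Defined.

Lemma restrict_lhom_id (A : Alg T) : restrict_lhom (lh_id A) = lh_id (restrict_alg A).
Proof. by apply: lhom_ext' => //; rewrite restrict_lhomE !lh_idE hcII. Qed.

Lemma restrict_lhom_comp (A B C : Alg T) (g : LHom B C) (f : LHom A B) :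
  restrict_lhom (lh_comp g f) = lh_comp (restrict_lhom g) (restrict_lhom f).
Proof.
apply: lhom_ext' => //.
rewrite restrict_lhomE !lh_compE !restrict_lhomE /= hc_vcr /= ?comp1A //.
by rewrite -!hcA !hcII mm_nat.
Qed.

Definition restrict_l : TwoFunctor (AlgL T) (AlgL S).
Proof.
unshelve refine (@Build_TwoFunctor (AlgL T) (AlgL S)
  (@MkPre (AlgL T) (AlgL S) restrict_alg restrict_lhom restrict_lcell) _ _ _ _ _) => /=.
- exact: restrict_lhom_id.
- exact: restrict_lhom_comp.
- by move=> A B f; apply: cellP; apply: lcell_ext.
- by move=> A B f g h y x; apply: cellP; apply: lcell_ext.
- by move=> A B C g g' f f' y x; apply: lcell_ext; rewrite -?restrict_lhom_comp.
Defined.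

End Restriction.

Record Pseudofunctor (X Y : TwoCat) := {
  ps_pre :> PreFunctor X Y;
  ps_gamma : forall (A B C : X) (g : hom B C) (f : hom A B),
    fmap ps_pre (g ∘ f) ⇒ fmap ps_pre g ∘ fmap ps_pre f;
  ps_gammaV : forall (A B C : X) (g : hom B C) (f : hom A B),
    fmap ps_pre g ∘ fmap ps_pre f ⇒ fmap ps_pre (g ∘ f);
  ps_iota : forall A : X, fmap ps_pre (id1 A) ⇒ id1 (ps_pre A);
  ps_iotaV : forall A : X, id1 (ps_pre A) ⇒ fmap ps_pre (id1 A);
  ps_gammaK : forall (A B C : X) (g : hom B C) (f : hom A B),
    ps_gammaV g f • ps_gamma g f = id2 _;
  ps_gammaVK : forall (A B C : X) (g : hom B C) (f : hom A B),
    ps_gamma g f • ps_gammaV g f = id2 _;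
  ps_iotaK : forall A : X, ps_iotaV A • ps_iota A = id2 _;
  ps_iotaVK : forall A : X, ps_iota A • ps_iotaV A = id2 _;
  ps_id2 : forall (A B : X) (f : hom A B), fmap2 ps_pre (id2 f) = id2 (fmap ps_pre f);
  ps_vcomp : forall (A B : X) (f g h : hom A B) (y : g ⇒ h) (x : f ⇒ g),
    fmap2 ps_pre (y • x) = fmap2 ps_pre y • fmap2 ps_pre x;
  ps_gamma_nat : forall (A B C : X) (g g' : hom B C) (f f' : hom A B)
    (y : g ⇒ g') (x : f ⇒ f'),
    ps_gamma g' f' • fmap2 ps_pre (y ∗ x) =
    (fmap2 ps_pre y ∗ fmap2 ps_pre x) • ps_gamma g f;
  ps_assoc : forall (A B C D : X) (h : hom C D) (g : hom B C) (f : hom A B),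
    (ps_gamma h g ▷ fmap ps_pre f) • ps_gamma (h ∘ g) f ≡
    (fmap ps_pre h ◁ ps_gamma g f) • ps_gamma h (g ∘ f);
  ps_unitr : forall (A B : X) (f : hom A B),
    (fmap ps_pre f ◁ ps_iota A) • ps_gamma f (id1 A) ≡ id2 (fmap ps_pre f);
  ps_unitl : forall (A B : X) (f : hom A B),
    (ps_iota B ▷ fmap ps_pre f) • ps_gamma (id1 B) f ≡ id2 (fmap ps_pre f)
}.
Arguments ps_gamma {X Y} F {A B C} g f : rename.
Arguments ps_gammaV {X Y} F {A B C} g f : rename.
Arguments ps_iota {X Y} F A : rename.
Arguments ps_iotaV {X Y} F A : rename.

Lemma eqc_inv (K : TwoCat) (A B : K) (f g : hom A B) (p : f = g) (q : g = f) :
  eqc q • eqc p = id2 f.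
Proof. by case: g / p q => q; rewrite (proof_irrelevance _ q eq_refl) vcomp_idl. Qed.

Definition pseudo_of_2functor (X Y : TwoCat) (F : TwoFunctor X Y) : Pseudofunctor X Y.
Proof.
unshelve refine
  {| ps_pre := tf_pre F;
     ps_gamma := fun A B C g f => eqc (tf_comp F g f);
     ps_gammaV := fun A B C g f => eqc (eq_sym (tf_comp F g f));
     ps_iota := fun A => eqc (tf_id F A);
     ps_iotaV := fun A => eqc (eq_sym (tf_id F A)) |}.
- by move=> *; apply: eqc_inv.
- by move=> *; apply: eqc_inv.
- by move=> *; apply: eqc_inv.
- by move=> *; apply: eqc_inv.
- exact: tf_id2.
- exact: tf_vcomp.
- move=> A B C g g' f f' y x; apply: cellP.
  rewrite /same_cell !vcE1 !eqcE' vcIl /= ?tf_comp //.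
  rewrite !hcE !(fcE F) hcE fc_hc vcIr /= ?tf_comp //.
- move=> A B C D h g f.
  rewrite /same_cell !vcE1 !hcE !eqcE' !idE !hcII !vcIl /= ?tf_comp //.
  by rewrite comp1A.
- move=> A B f.
  rewrite /same_cell !vcE1 !hcE !eqcE' !idE !hcII !vcIl /= ?comp1_idr.
  all: by rewrite tf_id comp1_idr.
- move=> A B f.
  by rewrite /same_cell !vcE1 !hcE !eqcE' !idE !hcII !vcIl /= ?comp1_idl ?tf_id ?comp1_idl.
Defined.

Definition ps_compose (X Y Z : TwoCat) (G : Pseudofunctor Y Z) (F : Pseudofunctor X Y) :
  Pseudofunctor X Z.
Proof.
unshelve refine
  {| ps_pre := pre_comp G F;
     ps_gamma := fun A B C g f =>
       ps_gamma G (fmap F g) (fmap F f) • fmap2 G (ps_gamma F g f);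
     ps_gammaV := fun A B C g f =>
       fmap2 G (ps_gammaV F g f) • ps_gammaV G (fmap F g) (fmap F f);
     ps_iota := fun A => ps_iota G (F A) • fmap2 G (ps_iota F A);
     ps_iotaV := fun A => fmap2 G (ps_iotaV F A) • ps_iotaV G (F A) |} => /=.
- move=> A B C g f; rewrite vcompA -(vcompA (fmap2 G _)) ps_gammaK vcomp_idr.
  by rewrite -ps_vcomp ps_gammaK ps_id2.
- move=> A B C g f; rewrite vcompA -(vcompA (ps_gamma G _ _)) -ps_vcomp ps_gammaVK.
  by rewrite ps_id2 vcomp_idr ps_gammaVK.
- move=> A; rewrite vcompA -(vcompA (fmap2 G _)) ps_iotaK vcomp_idr.
  by rewrite -ps_vcomp ps_iotaK ps_id2.
- move=> A; rewrite vcompA -(vcompA (ps_iota G _)) -ps_vcomp ps_iotaVK.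
  by rewrite ps_id2 vcomp_idr ps_iotaVK.
- by move=> A B f; rewrite !ps_id2.
- by move=> A B f g h y x; rewrite !ps_vcomp.
- move=> A B C g g' f f' y x.
  by rewrite -vcompA -ps_vcomp ps_gamma_nat ps_vcomp vcompA ps_gamma_nat -vcompA.
- move=> A B C D h g f.
  have eG := ps_assoc G (fmap F h) (fmap F g) (fmap F f).
  have eF := same_fmap2 G (ps_assoc F h g f).
  have n1 := ps_gamma_nat G (ps_gamma F h g) (id2 (fmap F f)).
  have n2 := ps_gamma_nat G (id2 (fmap F h)) (ps_gamma F g f).
  rewrite !ps_id2 in n1 n2.
  have -> : ((ps_gamma G (fmap F h) (fmap F g) • fmap2 G (ps_gamma F h g))
     ▷ fmap G (fmap F f)) •
     (ps_gamma G (fmap F (h ∘ g)) (fmap F f) • fmap2 G (ps_gamma F (h ∘ g) f)) =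
     ((ps_gamma G (fmap F h) (fmap F g) ▷ fmap G (fmap F f)) •
      ps_gamma G (fmap F h ∘ fmap F g) (fmap F f)) •
     fmap2 G ((ps_gamma F h g ▷ fmap F f) • ps_gamma F (h ∘ g) f).
    rewrite ps_vcomp !vcompA -(vcompA _ (ps_gamma G (_ ∘ _) _)) n1 !vcompA.
    by rewrite -interchange vcomp_idl.
  have -> : (fmap G (fmap F h) ◁
      (ps_gamma G (fmap F g) (fmap F f) • fmap2 G (ps_gamma F g f))) •
     (ps_gamma G (fmap F h) (fmap F (g ∘ f)) • fmap2 G (ps_gamma F h (g ∘ f))) =
     ((fmap G (fmap F h) ◁ ps_gamma G (fmap F g) (fmap F f)) •
      ps_gamma G (fmap F h) (fmap F g ∘ fmap F f)) •
     fmap2 G ((fmap F h ◁ ps_gamma F g f) • ps_gamma F h (g ∘ f)).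
    rewrite ps_vcomp !vcompA -(vcompA _ (ps_gamma G _ (_ ∘ _))) n2 !vcompA.
    by rewrite -interchange vcomp_idl.
  by rewrite /same_cell vcE1 [in RHS]vcE1 eG eF.
- move=> A B f.
  have eG := ps_unitr G (fmap F f).
  have eF := same_fmap2 G (ps_unitr F f).
  have n := ps_gamma_nat G (id2 (fmap F f)) (ps_iota F A).
  rewrite !ps_id2 in n eF.
  have -> : (fmap G (fmap F f) ◁ (ps_iota G (F A) • fmap2 G (ps_iota F A))) •
     (ps_gamma G (fmap F f) (fmap F (id1 A)) • fmap2 G (ps_gamma F f (id1 A))) =
     ((fmap G (fmap F f) ◁ ps_iota G (F A)) • ps_gamma G (fmap F f) (id1 (F A))) •
     fmap2 G ((fmap F f ◁ ps_iota F A) • ps_gamma F f (id1 A)).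
    rewrite ps_vcomp !vcompA -(vcompA _ (ps_gamma G _ (id1 _))) n !vcompA.
    by rewrite -interchange vcomp_idl.
  by rewrite /same_cell vcE1 eG eF !idE vcIl.
- move=> A B f.
  have eG := ps_unitl G (fmap F f).
  have eF := same_fmap2 G (ps_unitl F f).
  have n := ps_gamma_nat G (ps_iota F B) (id2 (fmap F f)).
  rewrite !ps_id2 in n eF.
  have -> : ((ps_iota G (F B) • fmap2 G (ps_iota F B)) ▷ fmap G (fmap F f)) •
     (ps_gamma G (fmap F (id1 B)) (fmap F f) • fmap2 G (ps_gamma F (id1 B) f)) =
     ((ps_iota G (F B) ▷ fmap G (fmap F f)) • ps_gamma G (id1 (F B)) (fmap F f)) •
     fmap2 G ((ps_iota F B ▷ fmap F f) • ps_gamma F (id1 B) f).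
    rewrite ps_vcomp !vcompA -(vcompA _ (ps_gamma G (id1 _) _)) n !vcompA.
    by rewrite -interchange vcomp_idl.
  by rewrite /same_cell vcE1 eG eF !idE vcIl.
Defined.

Definition ps_idf (X : TwoCat) : Pseudofunctor X X := pseudo_of_2functor (tf_idf X).

(* The components of a colax natural transformation, without its axioms:
   modifications, whiskerings and composites only involve these, and the two
   bracketings of a triple composite of pseudofunctors have the same data. *)
Record ColaxData (X Y : TwoCat) (G H : PreFunctor X Y) := {
  cx :> forall A : X, hom (G A) (H A);
  cx2 : forall (A B : X) (f : hom A B), cx B ∘ fmap G f ⇒ fmap H f ∘ cx A
}.
Arguments cx {X Y G H} α A : rename.
Arguments cx2 {X Y G H} α {A B} f : rename.

Record ColaxNat (X Y : TwoCat) (G H : Pseudofunctor X Y) := {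
  cn :> ColaxData G H;
  cn_nat : forall (A B : X) (f g : hom A B) (x : f ⇒ g),
    (fmap2 H x ▷ cn A) • cx2 cn f = cx2 cn g • (cn B ◁ fmap2 G x);
  cn_unit : forall A : X,
    (ps_iota H A ▷ cn A) • cx2 cn (id1 A) ≡ cn A ◁ ps_iota G A;
  cn_comp : forall (A B C : X) (g : hom B C) (f : hom A B),
    (ps_gamma H g f ▷ cn A) • cx2 cn (g ∘ f) ≡
    (fmap H g ◁ cx2 cn f) •[eq_sym (comp1A (fmap H g) (cn B) (fmap G f))]
    (cx2 cn g ▷ fmap G f) •[comp1A (cn C) (fmap G g) (fmap G f)]
    (cn C ◁ ps_gamma G g f)
}.

Record Modification (X Y : TwoCat) (G H : PreFunctor X Y) (α β : ColaxData G H) := {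
  md :> forall A : X, α A ⇒ β A;
  md_eq : forall (A B : X) (f : hom A B),
    (fmap H f ◁ md A) • cx2 α f = cx2 β f • (md B ▷ fmap G f)
}.
Arguments md {X Y G H α β} m A : rename.

Definition cx_id (X Y : TwoCat) (G : PreFunctor X Y) : ColaxData G G :=
  {| cx := fun A => id1 (G A);
     cx2 := fun A B f => eqc (eq_trans (comp1_idl (fmap G f)) (eq_sym (comp1_idr (fmap G f)))) |}.

Definition cx_comp (X Y : TwoCat) (G H P : PreFunctor X Y)
  (β : ColaxData H P) (α : ColaxData G H) : ColaxData G P :=
  {| cx := fun A => β A ∘ α A;
     cx2 := fun A B f =>
       recast (eq_sym (comp1A (β B) (α B) (fmap G f)))
         ((cx2 β f ▷ α A) •[comp1A (β B) (fmap H f) (α A)] (β B ◁ cx2 α f))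
         (eq_sym (comp1A (fmap P f) (β A) (α A))) |}.

Definition cx_whisker_r (X Y Z : TwoCat) (G H : PreFunctor Y Z)
  (α : ColaxData G H) (P : PreFunctor X Y) :
  ColaxData (pre_comp G P) (pre_comp H P) :=
  @Build_ColaxData X Z (pre_comp G P) (pre_comp H P)
    (fun A => α (P A)) (fun A B f => cx2 α (fmap P f)).

Definition cx_whisker_l (X Y Z : TwoCat) (P : Pseudofunctor Y Z)
  (G H : PreFunctor X Y) (α : ColaxData G H) :
  ColaxData (pre_comp P G) (pre_comp P H) :=
  @Build_ColaxData X Z (pre_comp P G) (pre_comp P H)
    (fun A => fmap P (α A))
    (fun A B f => ps_gamma P (fmap H f) (α A) • fmap2 P (cx2 α f) •
                  ps_gammaV P (α B) (fmap G f)).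

(* F is left colax adjoint to U. *)
Record ColaxAdjunction (X Y : TwoCat) (F : Pseudofunctor X Y) (U : Pseudofunctor Y X) := {
  ca_eta : ColaxNat (ps_idf X) (ps_compose U F);
  ca_eps : ColaxNat (ps_compose F U) (ps_idf Y);
  ca_Psi : Modification
    (cx_comp (cx_whisker_r ca_eps F) (cx_whisker_l F ca_eta)) (cx_id F);
  ca_Phi : Modification
    (cx_id U) (cx_comp (cx_whisker_l U ca_eps) (cx_whisker_r ca_eta U));
  ca_tri1 : forall A : X,
    ((ps_iota U (F A) • fmap2 U (ca_Psi A) •
      ps_gammaV U (ca_eps (F A)) (fmap F (ca_eta A))) ▷ ca_eta A)
    •[comp1A (fmap U (ca_eps (F A))) (fmap U (fmap F (ca_eta A))) (ca_eta A)]
    (fmap U (ca_eps (F A)) ◁ cx2 ca_eta (ca_eta A))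
    •[eq_sym (comp1A (fmap U (ca_eps (F A))) (ca_eta (U (F A))) (ca_eta A))]
    (ca_Phi (F A) ▷ ca_eta A)
    ≡ id2 (ca_eta A);
  ca_tri2 : forall B : Y,
    (ca_eps B ◁ ca_Psi (U B))
    •[eq_sym (comp1A (ca_eps B) (ca_eps (F (U B))) (fmap F (ca_eta (U B))))]
    (cx2 ca_eps (ca_eps B) ▷ fmap F (ca_eta (U B)))
    •[comp1A (ca_eps B) (fmap F (fmap U (ca_eps B))) (fmap F (ca_eta (U B)))]
    (ca_eps B ◁ (ps_gamma F (fmap U (ca_eps B)) (ca_eta (U B)) •
                 fmap2 F (ca_Phi B) • ps_iotaV F (U B)))
    ≡ id2 (ca_eps B)
}.

Definition has_left_colax_adjoint (X Y : TwoCat) (U : Pseudofunctor Y X) : Prop :=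
  exists F : Pseudofunctor X Y, inhabited (ColaxAdjunction F U).

(* Main.v *)
Require Import Defs.
From Stdlib Require Import ssreflect ClassicalEpsilon.

Set Implicit Arguments.
Unset Strict Implicit.
Unset Printing Implicit Defensive.

(** Write [J_T] for the inclusion of strict into lax [T]-morphisms, [L_T] for its
    left 2-adjoint, and likewise for [S]; write [U] for the restriction
    2-functor on lax morphisms and [G] for the left 2-adjoint of the
    restriction on strict ones.

    Restriction commutes with the inclusions, [U J_T = J_S θ*], so composing
    two 2-adjunctions shows that [A ↦ G (L_S A)] is left 2-adjoint to [U J_T]:
    every [A] has an arrow [η_A : A → U (J_T (G (L_S A)))] which is universal
    with respect to strict maps and algebra 2-cells between them
    ([universal_comp], [unit_universal]).  The left colax adjoint of [U] is
    [F A = J_T (G (L_S A))].  Along [η_A] a lax map out of [F A] cannot be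
    recovered from its transpose, but a 2-cell [s ⇒ l] with [s] strict and [l]
    only lax still can ([filler_exists], [filler_unique]); this is where
    lax-idempotence enters, as follows.  Put [C = G (L_S A)], let [n] and [q]
    be the unit and counit of [L_T ⊣ J_T], and let [c : C → L_T J_T C] be the
    strict map whose transpose is that of the lax map [n_C].  Then [q_C c = 1],
    and whiskering the counit of the adjunction [δ ⊣ q] at [C] yields a 2-cell
    [k : c q_C ⇒ 1] which makes [c] left adjoint to [q_C].  A lax map
    [l : C → B] is [m n_C] for a strict [m], so 2-cells [s ⇒ l] are strict
    2-cells [s q_C ⇒ m]; through [c ⊣ q_C] these are strict 2-cells
    [s ⇒ m c], and those correspond to their transposes.

    Whenever strict maps and fillers behave in this way, a left colax adjoint
    exists ([left_colax_adjoint]).  Unique lifting makes [F] a 2-functor and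
    [η] 2-natural; the counit [ε_B] is the strict map whose transpose is the
    identity of [U B]; and for a lax [f : A → B] the colax naturality cell
    [ε_f : ε_B (F (U f)) ⇒ f ε_A] is the filler whose transpose is the identity
    of [U f], which exists because its source is strict.  Both triangles then
    hold strictly, so [Ψ] and [Φ] are identities, and uniqueness of fillers
    gives every axiom for [ε]. *)

(** * 2-cells that are identities *)

Section Identities.
Variable K : TwoCat.

(** A 2-cell between provably equal 1-cells may be an identity without its type
    saying so; this predicate is closed under all operations, with no boundary
    conditions to check. *)
Definition is_identity (A B : K) (f g : hom A B) (x : f ⇒ g) : Prop := x ≡ id2 f.

Lemma is_identity_id2 (A B : K) (f : hom A B) : is_identity (id2 f).
Proof. by []. Qed.

Lemma is_identity_eqc (A B : K) (f g : hom A B) (p : f = g) : is_identity (eqc p).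
Proof. exact: eqcE. Qed.

Lemma is_identityP (A B : K) (f g : hom A B) (x : f ⇒ g) :
  is_identity x -> exists p : f = g, x = eqc p.
Proof.
move=> e; have p : f = g by exact: eq_sym (f_equal (@tgt _ _) e).
by exists p; apply: cellP; rewrite /same_cell eqcE.
Qed.

Lemma is_identity_vcomp (A B : K) (f g h : hom A B) (y : g ⇒ h) (x : f ⇒ g) :
  is_identity y -> is_identity x -> is_identity (y • x).
Proof.
move=> /is_identityP [p ->] /is_identityP [q ->].
by case: h / p {y}; case: g / q {x}; rewrite /= vcomp_idl.
Qed.

Lemma is_identity_vcompE (A B : K) (f g g' h : hom A B) (y : g' ⇒ h) (p : g = g')
  (x : f ⇒ g) : is_identity y -> is_identity x -> is_identity (y •[p] x).
Proof.
by move=> *; repeat first [apply: is_identity_eqc | apply: is_identity_vcomp].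
Qed.

Lemma is_identity_recast (A B : K) (f f' g g' : hom A B) (p : f' = f) (x : f ⇒ g)
  (q : g = g') : is_identity x -> is_identity (recast p x q).
Proof.
by move=> *; repeat first [apply: is_identity_eqc | apply: is_identity_vcomp].
Qed.

Lemma is_identity_hcomp (A B C : K) (g g' : hom B C) (f f' : hom A B)
  (y : g ⇒ g') (x : f ⇒ f') : is_identity y -> is_identity x -> is_identity (y ∗ x).
Proof.
move=> /is_identityP [p ->] /is_identityP [q ->].
by case: g' / p {y}; case: f' / q {x}; rewrite /= hcomp_id2.
Qed.

(** The coherence principle: of two parallel composites of identities only the
    boundary remains to be compared. *)
Lemma same_identities (A B : K) (f g f' g' : hom A B) (x : f ⇒ g) (y : f' ⇒ g') :
  is_identity x -> is_identity y -> g = g' -> x ≡ y.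
Proof.
move=> /is_identityP [p ->] /is_identityP [q ->] e.
by rewrite /same_cell !eqcE' e.
Qed.
End Identities.

Lemma is_identity_fmap2 (X Y : TwoCat) (F : TwoFunctor X Y) (A B : X) (f g : hom A B)
  (x : f ⇒ g) : is_identity x -> is_identity (fmap2 F x).
Proof.
by move=> /is_identityP [p ->]; case: g / p {x}; rewrite /= tf_id2.
Qed.

Ltac identities := repeat first
  [ assumption | apply: is_identity_eqc | apply: is_identity_id2 | apply: is_identity_vcompE
  | apply: is_identity_recast | apply: is_identity_vcomp | apply: is_identity_hcomp
  | apply: is_identity_fmap2 ].

(** * Universal arrows *)

Section Transpose.
Variables (X Y : TwoCat) (U : TwoFunctor Y X) (A : X) (C : Y) (u : hom A (U C)).

(** The action of the 2-functor followed by whiskering with [u], on cells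
    bundled with their boundaries; on identities it is the transposition of
    1-cells. *)
Definition transpose (B : Y) (x : tcell C B) : tcell A (U B) := hc (fc U x) (idc u).

Lemma transpose_vc (B : Y) (y x : tcell C B) :
  tgt x = src y -> transpose (vc y x) = vc (transpose y) (transpose x).
Proof. by move=> e; rewrite /transpose fc_vc // hc_vcr //= e. Qed.

Lemma transpose_hc (B D : Y) (y : tcell B D) (x : tcell C B) :
  transpose (hc y x) = hc (fc U y) (transpose x).
Proof. by rewrite /transpose fc_hc hcA. Qed.

Lemma transpose_id (B : Y) (s : hom C B) : transpose (idc s) = idc (fmap U s ∘ u).
Proof. by rewrite /transpose fcI hcII. Qed.

(** Bijectivity on bundled 2-cells includes bijectivity on 1-cells, which are
    the boundaries of identity 2-cells: this is an isomorphism of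
    hom-categories. *)
Definition universal : Prop := forall B : Y,
  (forall z : tcell A (U B), exists x : tcell C B, transpose x = z) /\
  (forall x y : tcell C B, transpose x = transpose y -> x = y).

(** Universality weakened for the lax setting: 1-cells lift uniquely among the
    strict ones only, while 2-cells are reflected as soon as their source is
    strict, whatever their target. *)
Record relatively_universal (strict : forall B B' : Y, hom B B' -> Prop) : Prop := {
  ru_lift : forall (B : Y) (h : hom A (U B)),
    exists s : hom C B, strict C B s /\ fmap U s ∘ u = h;
  ru_lift_inj : forall (B : Y) (s t : hom C B), strict C B s -> strict C B t ->
    fmap U s ∘ u = fmap U t ∘ u -> s = t;
  ru_fill : forall (B : Y) (s l : hom C B) (z : fmap U s ∘ u ⇒ fmap U l ∘ u),
    strict C B s -> exists x : s ⇒ l, fmap2 U x ▷ u = z;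
  ru_fill_inj : forall (B : Y) (s l : hom C B) (x y : s ⇒ l),
    strict C B s -> fmap2 U x ▷ u = fmap2 U y ▷ u -> x = y
}.
End Transpose.

Lemma universal_lift (X Y : TwoCat) (R : TwoFunctor Y X) (A : X) (C : Y)
  (u : hom A (R C)) (uP : universal u) (B : Y) (h : hom A (R B)) :
  exists s : hom C B, fmap R s ∘ u = h.
Proof.
have [x e] := proj1 (uP B) (idc h).
by exists (src x); exact: (f_equal (@src _ _) e).
Qed.

Lemma universal_lift_inj (X Y : TwoCat) (R : TwoFunctor Y X) (A : X) (C : Y)
  (u : hom A (R C)) (uP : universal u) (B : Y) (s t : hom C B) :
  fmap R s ∘ u = fmap R t ∘ u -> s = t.
Proof.
move=> e; have E : idc s = idc t by apply: (proj2 (uP B)); rewrite !transpose_id e.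
exact: (f_equal (@src _ _) E).
Qed.

Lemma universal_comp (X Y Z : TwoCat) (R : TwoFunctor Y X) (P : TwoFunctor Z Y)
  (A : X) (C : Y) (D : Z) (u : hom A (R C)) (v : hom C (P D)) :
  universal u -> universal v ->
  universal (U := tf_compose R P) (fmap R v ∘ u).
Proof.
move=> uP vP B.
have trE x : transpose (U := tf_compose R P) (fmap R v ∘ u) x = transpose u (transpose v x).
  by rewrite /transpose fc_hc -hcA fcI hcII.
split=> [z | x y].
- have [y <-] := proj1 (uP _) z; have [x <-] := proj1 (vP _) y.
  by exists x; rewrite trE.
- by rewrite !trE => /(proj2 (uP _)) /(proj2 (vP _)).
Qed.

(** * 2-adjunctions *)

Section Adjunction.
Variables (X Y : TwoCat) (L : TwoFunctor X Y) (R : TwoFunctor Y X) (a : TwoAdjunction L R).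

Let n : forall A : X, hom A (R (L A)) := ta_unit a.
Let q : forall B : Y, hom (L (R B)) B := ta_counit a.

Lemma adj_unit_nat (A B : X) (f : hom A B) : fmap R (fmap L f) ∘ n A = n B ∘ f.
Proof. exact: (tn_nat (ta_unit a)). Qed.

Lemma adj_unit_nat2 (A B : X) (x : tcell A B) :
  hc (fc R (fc L x)) (idc (n A)) = hc (idc (n B)) x.
Proof. case: x => f g x; exact: (tn_nat2 (ta_unit a) x). Qed.

Lemma adj_counit_nat (A B : Y) (f : hom A B) : f ∘ q A = q B ∘ fmap L (fmap R f).
Proof. exact: (tn_nat (ta_counit a)). Qed.

Lemma adj_counit_nat2 (A B : Y) (x : tcell A B) :
  hc x (idc (q A)) = hc (idc (q B)) (fc L (fc R x)).
Proof. case: x => f g x; exact: (tn_nat2 (ta_counit a) x). Qed.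

Lemma adj_triL (A : X) : q (L A) ∘ fmap L (n A) = id1 (L A).
Proof. exact: ta_triL. Qed.

Lemma adj_triR (B : Y) : fmap R (q B) ∘ n (R B) = id1 (R B).
Proof. exact: ta_triR. Qed.

Lemma unit_universal (A : X) : universal (n A).
Proof.
move=> B; split=> [z | x y e].
- exists (hc (idc (q B)) (fc L z)).
  by rewrite transpose_hc /transpose adj_unit_nat2 hcA fcI hcII adj_triR hcIl.
- have cancel (w : tcell (L A) B) : w = hc (idc (q B)) (fc L (transpose (n A) w)).
    by rewrite /transpose fc_hc fcI hcA -adj_counit_nat2 -hcA hcII adj_triL hcIr.
  by rewrite (cancel x) (cancel y) e.
Qed.

End Adjunction.

(** * Colax adjoints from relatively universal arrows *)

(** The 2-functor [U] is only assumed to have relatively universal arrows.  The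
    2-cells to be compared in [Y] have strict source, so that equations between
    them can be tested after transposition. *)
Section ColaxAdjoint.
Variables (X Y : TwoCat) (U : TwoFunctor Y X).
Variable strict : forall B B' : Y, hom B B' -> Prop.
Hypothesis strict_id : forall B : Y, strict (id1 B).
Hypothesis strict_comp : forall (B C D : Y) (t : hom C D) (s : hom B C),
  strict t -> strict s -> strict (t ∘ s).
Variables (F : X -> Y) (η : forall A : X, hom A (U (F A))).
Hypothesis ηP : forall A : X, relatively_universal (η A) (@strict).

Lemma lift_sig (A : X) (B : Y) (h : hom A (U B)) :
  {s : hom (F A) B | strict s /\ fmap U s ∘ η A = h}.
Proof. apply: constructive_indefinite_description; exact: (ru_lift (ηP A)). Qed.

Definition lift (A : X) (B : Y) (h : hom A (U B)) : hom (F A) B := proj1_sig (lift_sig h).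

Lemma lift_strict (A : X) (B : Y) (h : hom A (U B)) : strict (lift h).
Proof. exact: (proj1 (proj2_sig (lift_sig h))). Qed.

Lemma liftE (A : X) (B : Y) (h : hom A (U B)) : fmap U (lift h) ∘ η A = h.
Proof. exact: (proj2 (proj2_sig (lift_sig h))). Qed.

Lemma lift_uniq (A : X) (B : Y) (h : hom A (U B)) (s : hom (F A) B) :
  strict s -> fmap U s ∘ η A = h -> lift h = s.
Proof.
move=> Ps e; apply: (ru_lift_inj (ηP A)) => //; first exact: lift_strict.
by rewrite liftE e.
Qed.

Lemma fill_sig (A : X) (B : Y) (s l : hom (F A) B) (z : tcell A (U B)) :
  strict s -> src z = fmap U s ∘ η A -> tgt z = fmap U l ∘ η A ->
  {x : s ⇒ l | transpose (η A) (Cell x) = z}.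
Proof.
case: z => f g z /= Ps p q; apply: constructive_indefinite_description.
move: z; rewrite p q => z.
have [x <-] := ru_fill (ηP A) z Ps.
by exists x.
Qed.

(** The sources need not be assumed equal: being strict, they are determined by
    their transposes. *)
Lemma fill_inj (A : X) (B : Y) (x y : tcell (F A) B) :
  strict (src x) -> strict (src y) -> tgt x = tgt y ->
  transpose (η A) x = transpose (η A) y -> x = y.
Proof.
case: x y => s l x [t m y] /= Ps Pt e E.
have est : s = t.
  by apply: (ru_lift_inj (ηP A)) => //; exact: (f_equal (@src _ _) E).
case: t / est {Pt} y E => y E; case: m / e y E => y E.
by congr Cell; exact: (ru_fill_inj (ηP A) Ps (cellP E)).
Qed.

Definition left_map (A A' : X) (f : hom A A') : hom (F A) (F A') := lift (η A' ∘ f).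

(** A filler exists because [left_map f] is strict; the target [left_map g] is
    strict too, so vertical composites stay in the range of [fill_inj]. *)
Definition left_map2_sig (A A' : X) (f g : hom A A') (x : f ⇒ g) :
  {y : left_map f ⇒ left_map g |
   transpose (η A) (Cell y) = hc (idc (η A')) (Cell x)}.
Proof. by apply: fill_sig; rewrite /= ?liftE //; exact: lift_strict. Qed.

Definition left_map2 (A A' : X) (f g : hom A A') (x : f ⇒ g) : left_map f ⇒ left_map g :=
  proj1_sig (left_map2_sig x).

Lemma left_map2E (A A' : X) (f g : hom A A') (x : f ⇒ g) :
  transpose (η A) (Cell (left_map2 x)) = hc (idc (η A')) (Cell x).
Proof. exact: (proj2_sig (left_map2_sig x)). Qed.

Lemma left_map_strict (A A' : X) (f : hom A A') : strict (left_map f).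
Proof. exact: lift_strict. Qed.

Lemma left_map_id (A : X) : left_map (id1 A) = id1 (F A).
Proof. by apply: lift_uniq => //; rewrite tf_id comp1_idl comp1_idr. Qed.

Lemma left_map_comp (A B C : X) (g : hom B C) (f : hom A B) :
  left_map (g ∘ f) = left_map g ∘ left_map f.
Proof.
apply: lift_uniq; first by apply: strict_comp; exact: left_map_strict.
by rewrite tf_comp -comp1A liftE comp1A liftE comp1A.
Qed.

Definition left_functor : TwoFunctor X Y.
Proof.
refine (@Build_TwoFunctor X Y (@MkPre X Y F left_map left_map2)
  left_map_id left_map_comp _ _ _) => /=.
- move=> A A' f; apply: cellP; apply: fill_inj => //; try exact: left_map_strict.
  by rewrite left_map2E transpose_id liftE hcII.
- move=> A A' f g h y x; apply: cellP; apply: fill_inj => //; try exact: left_map_strict.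
  by rewrite left_map2E !vcE1 hc_vcl // transpose_vc // !left_map2E.
- move=> A B C g g' f f' y x; apply: fill_inj => /=.
  + exact: left_map_strict.
  + by apply: strict_comp; exact: left_map_strict.
  + exact: left_map_comp.
  + rewrite left_map2E !hcE transpose_hc left_map2E hcA.
    by rewrite -(left_map2E y) /transpose hcA.
Defined.

Lemma left_map2_eqc (A B : X) (f g : hom A B) (p : f = g) :
  is_identity (left_map2 (eqc p)).
Proof. exact: (is_identity_fmap2 left_functor (is_identity_eqc p)). Qed.

Lemma unit_nat (A B : X) (f : hom A B) : η B ∘ f = fmap U (left_map f) ∘ η A.
Proof. by rewrite liftE. Qed.

Definition unit_data : ColaxData (ps_idf X) (pre_comp U left_functor) :=
  @Build_ColaxData X X (ps_idf X) (pre_comp U left_functor) η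
   (fun A B f => eqc (unit_nat f)).

Definition unit_colax :
  ColaxNat (ps_idf X) (ps_compose (pseudo_of_2functor U) (pseudo_of_2functor left_functor)).
Proof.
exists unit_data => /=.
- move=> A B f g x; apply: cellP; rewrite /same_cell !vcE1 !hcE /=.
  rewrite (fcE U) eqcE eqcE' vcIl /=; first exact: unit_nat.
  rewrite vcIr /=; first by rewrite unit_nat.
  exact: left_map2E.
- move=> A; apply: same_identities; identities.
  by rewrite comp1_idl comp1_idr.
- move=> A B C g f; apply: same_identities; identities.
  by rewrite comp1A.
Defined.

Definition counit_at (B : Y) : hom (F (U B)) B := lift (id1 (U B)).

Lemma counit_strict (B : Y) : strict (counit_at B).
Proof. exact: lift_strict. Qed.

Lemma counit_unit (B : Y) : fmap U (counit_at B) ∘ η (U B) = id1 (U B).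
Proof. exact: liftE. Qed.

Lemma counit_src (A B : Y) (f : hom A B) :
  fmap U (counit_at B ∘ left_map (fmap U f)) ∘ η (U A) = fmap U f.
Proof. by rewrite tf_comp -comp1A liftE comp1A counit_unit comp1_idl. Qed.

Lemma counit_tgt (A B : Y) (f : hom A B) :
  fmap U (f ∘ counit_at A) ∘ η (U A) = fmap U f.
Proof. by rewrite tf_comp -comp1A counit_unit comp1_idr. Qed.

Lemma counit_src_strict (A B : Y) (f : hom A B) :
  strict (counit_at B ∘ left_map (fmap U f)).
Proof. by apply: strict_comp; exact: lift_strict. Qed.

(** Both composites have the transpose [U f]; the cell comparing them is the
    filler of the identity.  It cannot be inverted in general, since its target
    is not strict: this is what makes the adjunction merely colax. *)
Definition counit_cell_sig (A B : Y) (f : hom A B) :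
  {x : counit_at B ∘ left_map (fmap U f) ⇒ f ∘ counit_at A |
   transpose (η (U A)) (Cell x) = idc (fmap U f)}.
Proof.
apply: fill_sig; rewrite /= ?counit_src ?counit_tgt //; exact: counit_src_strict.
Qed.

Definition counit_cell (A B : Y) (f : hom A B) :
  counit_at B ∘ left_map (fmap U f) ⇒ f ∘ counit_at A :=
  proj1_sig (counit_cell_sig f).

Lemma counit_cellE (A B : Y) (f : hom A B) :
  transpose (η (U A)) (Cell (counit_cell f)) = idc (fmap U f).
Proof. exact: (proj2_sig (counit_cell_sig f)). Qed.

(** When [f] is strict, so is the target of the filler, and a filler of an
    identity between two strict maps is an identity.  Hence the counit is natural for strict maps, in particular at [left_map f]
    and at its own components, which is all that the triangles involve. *)
Lemma counit_cell_strict (A B : Y) (f : hom A B) :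
  strict f -> is_identity (counit_cell f).
Proof.
move=> Pf; have Pt : strict (f ∘ counit_at A).
  by apply: strict_comp => //; exact: counit_strict.
apply: fill_inj => /=; try exact: counit_src_strict.
  apply: (ru_lift_inj (ηP _)); rewrite ?counit_tgt ?counit_src //.
  exact: counit_src_strict.
by rewrite counit_cellE transpose_id counit_src.
Qed.

Definition counit_data : ColaxData (pre_comp left_functor U) (pre_id Y) :=
  @Build_ColaxData Y Y (pre_comp left_functor U) (pre_id Y) counit_at counit_cell.

(** For local naturality both sides are cells with strict source that transpose
    to [U x], for composition to an identity; the unit axiom only involves
    identities, as [id1] is strict. *)
Definition counit_colax :
  ColaxNat (ps_compose (pseudo_of_2functor left_functor) (pseudo_of_2functor U)) (ps_idf Y).
Proof.
exists counit_data => /=.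
- move=> A B f g x; apply: cellP; rewrite /same_cell !vcE1 !hcE /=.
  apply: fill_inj => /=.
  + by rewrite vcs //=; exact: counit_src_strict.
  + by rewrite vcs //=; exact: counit_src_strict.
  + by rewrite !vct.
  + rewrite !transpose_vc // !counit_cellE !transpose_hc left_map2E transpose_id.
    rewrite counit_unit hcIr hcA fcI hcII counit_unit hcIl vcIr // vcIl //.
- move=> A; apply: same_identities; identities.
  + exact: counit_cell_strict.
  + exact: left_map2_eqc.
  + by rewrite comp1_idl comp1_idr.
- move=> A B C g f; rewrite /same_cell !vcE !vcE1 !hcE !vcE1 /= !eqcE'.
  (* The structure cells of the 2-functors are identities and drop out. *)
  rewrite left_map2_eqc [vc (idc _) (idc _)]vcIl /=; first by rewrite tf_comp left_map_comp.
  rewrite !hcII vcIl // vcIr /=; first by rewrite vcs /= ?tf_comp ?left_map_comp comp1A.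
  apply: fill_inj => /=.
  + exact: counit_src_strict.
  + rewrite vcs /= ?comp1A //.
    by apply: strict_comp; [exact: counit_src_strict|exact: left_map_strict].
  + by rewrite vct /= comp1A.
  + rewrite transpose_vc /= ?comp1A // !transpose_hc !counit_cellE transpose_id.
    rewrite liftE -hcII hcA.
    rewrite [hc (fc U _) (idc (η _))](counit_cellE g) fcI !hcII.
    by rewrite tf_comp vcIl.
Defined.

Lemma counit_left_unit (A : X) : counit_at (F A) ∘ left_map (η A) = id1 (F A).
Proof.
apply: (ru_lift_inj (ηP A)) => //.
  by apply: strict_comp; [exact: counit_strict|exact: left_map_strict].
by rewrite tf_comp -comp1A liftE comp1A counit_unit tf_id.
Qed.

Definition triangle_left : Modification
  (cx_comp (cx_whisker_r counit_colax left_functor)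
           (cx_whisker_l (pseudo_of_2functor left_functor) unit_colax))
  (cx_id left_functor).
Proof.
exists (fun A => eqc (counit_left_unit A)) => /=.
move=> A B f; apply: cellP; apply: same_identities => //; identities.
- by apply: counit_cell_strict; exact: left_map_strict.
- exact: left_map2_eqc.
Defined.

(** Here the naturality cell occurs at an arbitrary [f], but only after applying
    [U] and whiskering with the unit, where it is an identity by construction. *)
Definition triangle_right : Modification
  (cx_id U)
  (cx_comp (cx_whisker_l (pseudo_of_2functor U) counit_colax)
           (cx_whisker_r unit_colax U)).
Proof.
exists (fun B => eqc (eq_sym (counit_unit B))) => /=.
move=> A B f; apply: cellP.
have filler : is_identity
    ((cx2 (cx_whisker_l (pseudo_of_2functor U) counit_colax) f) ▷ η (U A)).
  rewrite /is_identity /same_cell hcE /= !vcE1 !eqcE' vcIl /=; first by rewrite tf_comp.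
  rewrite vcIr /=; first by rewrite tf_comp.
  rewrite [hc _ _](counit_cellE f).
  by rewrite -tf_comp counit_src.
by apply: same_identities; identities.
Defined.

Lemma left_colax_adjoint : has_left_colax_adjoint (pseudo_of_2functor U).
Proof.
exists (pseudo_of_2functor left_functor); split.
refine {| ca_eta := unit_colax; ca_eps := counit_colax;
  ca_Psi := triangle_left; ca_Phi := triangle_right |} => /=.
- move=> A; apply: same_identities => //; identities.
  exact: comp1_idl.
- move=> B; apply: same_identities => //; identities.
  + by apply: counit_cell_strict; exact: counit_strict.
  + exact: left_map2_eqc.
  + exact: comp1_idr.
Qed.
End ColaxAdjoint.

(** * Lax-idempotence supplies the fillers *)

Lemma cell_with_boundary (K : TwoCat) (A B : K) (f g : hom A B) (x : tcell A B) :
  src x = f -> tgt x = g -> exists y : f ⇒ g, Cell y = x.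
Proof.
by case: x => f' g' x /= e e'; case: f / e; case: g / e'; exists x.
Qed.

(** [C] represents [A] for strict maps, through [u].  The section [c] of the
    counit, which elsewhere would come from a coalgebra structure on [C], is
    obtained from this universality. *)
Section Fillers.
Variables (W X Y : TwoCat) (J : TwoFunctor W Y) (L : TwoFunctor Y W) (a : TwoAdjunction L J).
Hypothesis laxa : lax_idempotent_comonad (comonad_of_adjunction a).
Variables (U : TwoFunctor Y X) (A : X) (C : W) (u : hom A (U (J C))).
Hypothesis uP : universal (U := tf_compose U J) u.

Let n : forall B : Y, hom B (J (L B)) := ta_unit a.
Let q : forall B : W, hom (L (J B)) B := ta_counit a.

Definition mate (B : W) (x : tcell (J C) (J B)) : tcell (L (J C)) B :=
  hc (idc (q B)) (fc L x).

(** [mate x] is the 2-cell corresponding to [x] under [L ⊣ J], as [n] is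
    2-natural and satisfies the triangle identity. *)
Lemma mateK (B : W) (x : tcell (J C) (J B)) :
  hc (fc J (mate x)) (idc (n (J C))) = x.
Proof. by rewrite fc_hc fcI -hcA adj_unit_nat2 hcA hcII adj_triR hcIl. Qed.

(** The strict approximation of the unit at [C]: both have the same restriction
    along [u]. *)
Variable c : hom C (L (J C)).
Hypothesis cE : fmap U (fmap J c) ∘ u = fmap U (n (J C)) ∘ u.

Lemma cE_whisker (B : W) (y : tcell (L (J C)) B) :
  transpose (U := tf_compose U J) u (hc y (idc c)) =
  transpose u (hc (fc J y) (idc (n (J C)))).
Proof.
rewrite /transpose !fc_hc -!hcA !fcI !hcII.
by rewrite /= cE.
Qed.

Lemma c_section : q C ∘ c = id1 C.
Proof.
apply: (universal_lift_inj uP) => /=.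
by rewrite !tf_comp -comp1A cE comp1A -tf_comp adj_triR !tf_id.
Qed.

(** Lax-idempotence read in the calculus of bundled cells: as the unit of
    [δ ⊣ q] is an identity, the triangle identities say that whiskering the
    counit with [δ] or with [q] gives an identity. *)
Lemma lax_counit (D : W) : exists e : tcell (L (J (L (J D)))) (L (J (L (J D)))),
  src e = fmap L (n (J D)) ∘ q (L (J D)) /\ tgt e = id1 _ /\
  hc e (idc (fmap L (n (J D)))) = idc (fmap L (n (J D))) /\
  hc (idc (q (L (J D)))) e = idc (q (L (J D))).
Proof.
have [p [e [tri1 tri2]]] := laxa D; exists (Cell e).
split=> //; split=> //; move: tri1 tri2.
rewrite /same_cell !vcE !hcE !eqcE !idE !hcII => tri1 tri2; split.
- move: tri1; rewrite vcIr //=.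
  by rewrite comp1_idr -comp1A -/q -/n adj_triL comp1_idr.
- move: tri2; rewrite vcIr //=.
  by rewrite comp1A -/q -/n adj_triL.
Qed.

(** The counit [k] of [c ⊣ q_C] is [e] whiskered by [L J q_C] and [L J c],
    where [e] is the counit of [δ ⊣ q] at [C].  Of the triangle identities,
    [q_C k = 1] reduces to [q e = 1].  The one for [k c] is needed in the form
    of its transpose: along [u] and [n], the map [L J c] agrees with
    [δ = L n_C], and [e δ = 1]. *)
Lemma counit_of_section : exists k : tcell (L (J C)) (L (J C)),
  src k = c ∘ q C /\ tgt k = id1 (L (J C)) /\ hc (idc (q C)) k = idc (q C) /\
  transpose u (hc (fc J k) (idc (n (J C)))) = idc (fmap U (n (J C)) ∘ u).
Proof.
have [e [se [te [e_delta q_e]]]] := lax_counit C.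
exists (hc (idc (fmap L (fmap J (q C)))) (hc e (idc (fmap L (fmap J c))))).
have Lqc : fmap L (fmap J (q C)) ∘ fmap L (fmap J c) = id1 (L (J C)).
  by rewrite -!tf_comp c_section !tf_id.
split; last split; last split.
- rewrite /= se -comp1A -adj_counit_nat !comp1A.
  by rewrite -(tf_comp L) adj_triR tf_id comp1_idl.
- by rewrite /= te comp1_idl.
- rewrite !hcA hcII -adj_counit_nat -hcII -(hcA _ _ e) q_e !hcII.
  by rewrite -comp1A -adj_counit_nat comp1A c_section comp1_idl.
- have step : fmap U (fmap J (fmap L (fmap J c)) ∘ n (J C)) ∘ u =
     fmap U (fmap J (fmap L (n (J C))) ∘ n (J C)) ∘ u.
    by rewrite !adj_unit_nat !tf_comp -!comp1A cE.
  have fixed : hc (fc J e) (idc (fmap J (fmap L (n (J C))) ∘ n (J C))) =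
     idc (fmap J (fmap L (n (J C))) ∘ n (J C)).
    by rewrite -hcII hcA -fcI -fc_hc e_delta.
  rewrite !fc_hc !fcI -!hcA hcII !transpose_hc transpose_id step.
  rewrite -transpose_id -transpose_hc fixed transpose_id fcI hcII.
  rewrite comp1A -tf_comp comp1A -(tf_comp J) -tf_comp adj_triR.
  by rewrite !tf_id comp1_idl.
Qed.

(** A cell [y] out of [s q_C] is recovered from [y c], because pasting [k] onto
    [y c q_C] gives back [y]; and [y c] is a cell out of [C], determined by its
    transpose. *)
Lemma transpose_mono (k : tcell (L (J C)) (L (J C))) (B : W) (s : hom C B)
  (x y : tcell (J C) (J B)) :
  src k = c ∘ q C -> tgt k = id1 (L (J C)) -> hc (idc (q C)) k = idc (q C) ->
  src x = fmap J s -> src y = fmap J s -> tgt x = tgt y ->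
  transpose u x = transpose u y -> x = y.
Proof.
move=> sk tk qk sx sy txy e.
have src_mate z : src z = fmap J s -> src (mate z) = s ∘ q C.
  by move=> /= ->; rewrite adj_counit_nat.
(* Interchange of [mate z] with [k] leaves [s q_C k], an identity. *)
have mateE z : src z = fmap J s ->
    mate z = vc (hc (idc (tgt (mate z))) k) (hc (hc (mate z) (idc c)) (idc (q C))).
  move=> sz; rewrite -hcA hcII -sk slide tk hcIr src_mate // -hcII -hcA qk hcII vcIr //.
  exact: src_mate.
rewrite -(mateK x) -(mateK y); congr (hc (fc J _) _).
have ec : hc (mate x) (idc c) = hc (mate y) (idc c).
  by apply: (proj2 (uP B)); rewrite !cE_whisker !mateK.
have et : tgt (mate x) = tgt (mate y) by rewrite /= txy.
by rewrite (mateE x) // (mateE y) // ec et.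
Qed.
End Fillers.

Section LaxIdempotence.
Variables (W X Y : TwoCat) (J : TwoFunctor W Y) (L : TwoFunctor Y W) (a : TwoAdjunction L J).
Hypothesis laxa : lax_idempotent_comonad (comonad_of_adjunction a).
Variables (U : TwoFunctor Y X) (A : X) (C : W) (u : hom A (U (J C))).
Hypothesis uP : universal (U := tf_compose U J) u.

(** Write [l] as [m n] with [m] strict.  A cell [z] lifts by universality to a
    cell [y : s ⇒ m c] between strict maps, and is corrected by the cell
    [w : c ⇒ n], a whiskering of [k] whose transpose is an identity. *)
Lemma filler_exists (B : W) (s : hom C B) (l : hom (J C) (J B))
  (z : fmap U (fmap J s) ∘ u ⇒ fmap U l ∘ u) :
  exists x : fmap J s ⇒ l, fmap2 U x ▷ u = z.
Proof.
have [c cE] := universal_lift uP (fmap U (ta_unit a (J C)) ∘ u).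
have [k [sk [tk [qk wk]]]] := counit_of_section laxa uP cE.
have [y ey] := proj1 (uP B) (Cell z).
pose m : hom (L (J C)) B := ta_counit a B ∘ fmap L l.
have lE : fmap J m ∘ ta_unit a (J C) = l.
  by rewrite /m tf_comp -comp1A adj_unit_nat comp1A adj_triR comp1_idl.
have [w [sw [tw ew]]] : exists w, src w = fmap J c /\ tgt w = ta_unit a (J C) /\
    transpose u w = idc (fmap U (ta_unit a (J C)) ∘ u).
  exists (hc (fc J k) (idc (ta_unit a (J C)))); split; last split => //=.
    by rewrite /= sk tf_comp -comp1A adj_triR comp1_idr.
  by rewrite tk tf_id comp1_idl.
have sy : src y = s by apply: (universal_lift_inj uP); exact: (f_equal (@src _ _) ey).
have ty : tgt y = m ∘ c.
  apply: (universal_lift_inj uP); rewrite [LHS](f_equal (@tgt _ _) ey) /=.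
  by rewrite !tf_comp -comp1A cE comp1A -!tf_comp lE.
pose x := vc (hc (idc (fmap J m)) w) (fc J y).
have bd : tgt (fc J y) = src (hc (idc (fmap J m)) w) by rewrite /= ty tf_comp sw.
have ex : transpose u x = Cell z.
  rewrite /x transpose_vc // transpose_hc ew fcI hcII -ey vcIl //.
  by rewrite /= ty !tf_comp -comp1A cE.
have sx : src x = fmap J s by rewrite vcs //= sy.
have tx : tgt x = l by rewrite vct /= tw.
have [x' ex'] := cell_with_boundary sx tx.
by exists x'; apply: cellP; move: ex; rewrite -ex'.
Qed.

Lemma filler_unique (B : W) (s : hom C B) (l : hom (J C) (J B)) (x y : fmap J s ⇒ l) :
  fmap2 U x ▷ u = fmap2 U y ▷ u -> x = y.
Proof.
move=> e.
have [c cE] := universal_lift uP (fmap U (ta_unit a (J C)) ∘ u).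
have [k [sk [tk [qk _]]]] := counit_of_section laxa uP cE.
apply: cellP; apply: (transpose_mono uP cE sk tk qk (s := s)) => //.
by rewrite /transpose /fc /hc /= e.
Qed.
End LaxIdempotence.

(** * Lax morphisms of algebras *)

Section PropertyLAdjoint.
Variables (K : TwoCat) (T : TwoMonad K).
Hypothesis hT : PropertyL T.

Definition is_strict (A B : AlgL T) (f : hom A B) : Prop :=
  exists s : SHom A B, f = lax_of_strict s.

(** The inclusion is the identity on objects, so every object is of the form
    [J B], as the fillers require of the target. *)
Lemma relatively_universal_of_universal (X : TwoCat) (U : TwoFunctor (AlgL T) X)
  (A : X) (C : AlgL T) (u : hom A (U C)) :
  universal (U := tf_compose U (inclusionJ T)) (C := C) u ->
  relatively_universal u is_strict.
Proof.
case: hT => L [a laxa] uP; split.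
- move=> B h; have [s e] := universal_lift uP (h : hom A (tf_compose U (inclusionJ T) B)).
  by exists (lax_of_strict s); split=> //; exists s.
- move=> B s t [s' ->] [t' ->] e; congr lax_of_strict.
  exact: (universal_lift_inj uP e).
- move=> B s l z [s' es]; move: z; rewrite es => z.
  exact: (filler_exists laxa uP (B := B) (s := s')).
- move=> B s l x y [s' es]; case: _ / (eq_sym es) x y => x y.
  exact: (filler_unique laxa uP (B := B) (s := s')).
Qed.

(** The general form of the result: a 2-functor on lax morphisms has a left
    colax adjoint as soon as its restriction to strict morphisms has a left
    2-adjoint. *)
Theorem colax_adjoint_of_strict_adjoint (X : TwoCat) (U : TwoFunctor (AlgL T) X) :
  (forall A : X, exists (C : AlgS T) (u : hom A (tf_compose U (inclusionJ T) C)),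
     universal u) ->
  has_left_colax_adjoint (pseudo_of_2functor U).
Proof.
move=> h.
pose F A := proj1_sig (constructive_indefinite_description _ (h A)).
have hη A : exists u : hom A (tf_compose U (inclusionJ T) (F A)), universal u.
  exact: (proj2_sig (constructive_indefinite_description _ (h A))).
pose η A := proj1_sig (constructive_indefinite_description _ (hη A)).
have ηP A : universal (η A).
  exact: (proj2_sig (constructive_indefinite_description _ (hη A))).
apply: (@left_colax_adjoint X (AlgL T) U is_strict _ _ F η).
- by move=> B; exists (sh_id B).
- move=> B C D t s [t' ->] [s' ->]; exists (sh_comp t' s').
  by rewrite lax_of_strict_comp.
- move=> A; exact: relatively_universal_of_universal.
Qed.
End PropertyLAdjoint.

Lemma restrict_inclusion (K : TwoCat) (T S : TwoMonad K) (θ : MonadMorphism S T)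
  (A B : Alg T) (x : @tcell (AlgS T) A B) :
  fc (tf_compose (restrict_l θ) (inclusionJ T)) x =
  fc (tf_compose (inclusionJ S) (restrict_s θ)) x.
Proof.
have e (f : SHom A B) : restrict_lhom θ (lax_of_strict f) = lax_of_strict (restrict_shom θ f).
  by apply: lhom_ext' => //; rewrite restrict_lhomE !lcl_strict hcII -comp1A.
by case: x => f g x; apply: lcell_ext; try exact: e.
Qed.

Theorem corollary5p10 (K : TwoCat) (T S : TwoMonad K)
  (hT : PropertyL T) (hS : PropertyL S) (θ : MonadMorphism S T)
  (hθ : has_left_2adjoint (restrict_s θ)) :
  has_left_colax_adjoint (pseudo_of_2functor (restrict_l θ)).
Proof.
case: hS => L [a _]; case: hθ => G [b].
apply: colax_adjoint_of_strict_adjoint => // A.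
pose v := fmap (inclusionJ S) (ta_unit b (L A)) ∘ ta_unit a A.
exists (G (L A)), v => B.
have := universal_comp (unit_universal a A) (unit_universal b (L A)) B.
have trE x : transpose (U := tf_compose (restrict_l θ) (inclusionJ T))
    v x = transpose (U := tf_compose (inclusionJ S) (restrict_s θ)) v x.
  by rewrite /transpose restrict_inclusion.
case=> ex inj; split=> [z | x y].
- by have [x <-] := ex z; exists x; exact: trE.
- by move=> e; apply: inj; rewrite -[LHS]trE -[RHS]trE.
Qed.
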